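(* Let $G$ be a group acting properly by isometries on two proper CAT(0) spaces $X_1$ and $X_2$, each action having rank-1 isometries. If the diagonal action of $G$ on $X_1\times X_2$ is convex co-compact, then up to rescaling the two actions $G\curvearrowright X_1$ and $G\curvearrowright X_2$ have the same marked length spectrum.
   Context: A rank-1 isometry of a CAT(0) space is an axial isometry (one translating some geodesic line, its axis, nontrivially) having an axis that does not bound a flat half-plane. An action ''has rank-1 isometries'' if some element of $G$ acts as a rank-1 isometry. $X_1\times X_2$ carries the $\ell^2$-product metric, which is CAT(0). An isometric action of $G$ on a CAT(0) space $Y$ is convex co-compact if there is a nonempty closed convex $G$-invariant subset of $Y$ on which $G$ acts cocompactly. The marked length spectrum of $G\curvearrowright X$ is the function $G\to[0,\infty)$, $g\mapsto \ell_X(g)=\inf_{x\in X}d(x,gx)$. Two actions have the same marked length spectrum up to rescaling if there is a constant $\lambda>0$ with $\ell_{X_1}(g)=\lambda\,\ell_{X_2}(g)$ for all $g\in G$. *)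

(* Defs.v *)
From HB Require Import structures.
From mathcomp Require Import all_boot all_order all_algebra.
From mathcomp Require Import all_classical all_reals all_analysis.
From mathcomp Require Import ring lra.

Set Implicit Arguments.
Unset Strict Implicit.
Unset Printing Implicit Defensive.

Import Order.TTheory GRing.Theory Num.Theory.

Local Open Scope classical_set_scope.
Local Open Scope ring_scope.

(* The library's own metric topology on [X1 * X2] comes from the sup distance,
   hence an alias of the product type for the l^2 distance. *)
Definition l2prod (X1 X2 : Type) : Type := (X1 * X2)%type.

Section L2Product.
Context {R : realType} {X1 X2 : metricType R}.
Implicit Types p q r : l2prod X1 X2.

Let dist p q : R := Num.sqrt (mdist p.1 q.1 ^+ 2 + mdist p.2 q.2 ^+ 2).

Let distxx p : dist p p = 0.
Proof. by rewrite /dist !mdistxx expr0n addr0 sqrtr0. Qed.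

Let dist_positivity p q : dist p q = 0 -> p = q.
Proof.
move=> /eqP; rewrite /dist sqrtr_eq0 => le0.
have := sqr_ge0 (mdist p.1 q.1); have := sqr_ge0 (mdist p.2 q.2) => h2 h1.
have /eqP : mdist p.1 q.1 ^+ 2 = 0 by lra.
rewrite sqrf_eq0 => /eqP /mdist_positivity e1.
have /eqP : mdist p.2 q.2 ^+ 2 = 0 by lra.
rewrite sqrf_eq0 => /eqP /mdist_positivity e2.
by case: p q e1 e2 {le0 h1 h2} => [p1 p2] [q1 q2] /= -> ->.
Qed.

Let dist_sym p q : dist p q = dist q p.
Proof. by rewrite /dist metric_sym (metric_sym p.2). Qed.

Let dist_triangle q p r : dist p r <= dist p q + dist q r.
Proof.
rewrite /dist; set a := mdist p.1 q.1; set b := mdist p.2 q.2.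
set c := mdist q.1 r.1; set d := mdist q.2 r.2.
have [a0 b0 c0 d0] : [/\ 0 <= a, 0 <= b, 0 <= c & 0 <= d].
  by split; exact: mdist_ge0.
have h1 : mdist p.1 r.1 <= a + c by exact: metric_triangle.
have h2 : mdist p.2 r.2 <= b + d by exact: metric_triangle.
have s1 : 0 <= a ^+ 2 + b ^+ 2 by rewrite addr_ge0 ?sqr_ge0.
have s2 : 0 <= c ^+ 2 + d ^+ 2 by rewrite addr_ge0 ?sqr_ge0.
have u0 := sqrtr_ge0 (a ^+ 2 + b ^+ 2).
have v0 := sqrtr_ge0 (c ^+ 2 + d ^+ 2).
rewrite -[leRHS]ger0_norm ?addr_ge0// -sqrtr_sqr ler_wsqrtr//.
have cs : a * c + b * d <=
    Num.sqrt (a ^+ 2 + b ^+ 2) * Num.sqrt (c ^+ 2 + d ^+ 2).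
  rewrite -sqrtrM// -[leLHS]ger0_norm ?addr_ge0 ?mulr_ge0//.
  rewrite -sqrtr_sqr ler_wsqrtr//.
  by have := sqr_ge0 (a * d - b * c); nra.
apply: (@le_trans _ _ ((a + c) ^+ 2 + (b + d) ^+ 2)).
  by rewrite lerD// lerXn2r// ?nnegrE ?addr_ge0 ?mdist_ge0.
rewrite (sqrrD (Num.sqrt _)) !sqr_sqrtr//; lra.
Qed.

HB.instance Definition _ := Choice.on (l2prod X1 X2).
HB.instance Definition _ := isMetric.Build R (l2prod X1 X2)
  distxx dist_positivity dist_sym dist_triangle.

Lemma mdist_l2prodE p q :
  mdist p q = Num.sqrt (mdist p.1 q.1 ^+ 2 + mdist p.2 q.2 ^+ 2) :> R.
Proof. by []. Qed.

End L2Product.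

(* The Euclidean plane. *)
Definition plane (R : realType) : metricType R := l2prod R^o R^o.

Section CAT0.
Context {R : realType}.
Implicit Type X : metricType R.

Definition proper_space X :=
  forall (x : X) (r : R), compact [set y : X | mdist x y <= r].

Definition geodesic_path X (x y : X) (c : R -> X) :=
  [/\ c 0 = x, c (mdist x y) = y &
      {in `[0, mdist x y] &, forall s t, mdist (c s) (c t) = `|s - t|}].

Definition geodesic_space X :=
  forall x y : X, exists c : R -> X, geodesic_path x y c.

(* The cyclic successor [ordS] on ['I_3] makes [i, ordS i] range over the
   three sides. *)
Definition geodesic_triangle X (v : 'I_3 -> X) (c : 'I_3 -> R -> X) :=
  forall i, geodesic_path (v i) (v (ordS i)) (c i).

(* [c' i s] is the comparison point of [c i s]. *)
Definition cat0_space X :=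
  geodesic_space X /\
  forall (v : 'I_3 -> X) (c : 'I_3 -> R -> X)
         (v' : 'I_3 -> plane R) (c' : 'I_3 -> R -> plane R),
    geodesic_triangle v c -> geodesic_triangle v' c' ->
    (forall i j, mdist (v' i) (v' j) = mdist (v i) (v j)) ->
    forall (i j : 'I_3) (s t : R),
      s \in `[0, mdist (v i) (v (ordS i))] ->
      t \in `[0, mdist (v j) (v (ordS j))] ->
      mdist (c i s) (c j t) <= mdist (c' i s) (c' j t).

Definition geodesically_convex X (C : set X) :=
  forall (x y : X) (c : R -> X), C x -> C y -> geodesic_path x y c ->
    forall t, t \in `[0, mdist x y] -> C (c t).

Definition is_isometry X (f : X -> X) :=
  bijective f /\ forall x y, mdist (f x) (f y) = mdist x y.

Definition geodesic_line X (c : R -> X) :=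
  forall s t, mdist (c s) (c t) = `|s - t|.

Definition axis X (f : X -> X) (c : R -> X) :=
  geodesic_line c /\ exists2 a : R, a != 0 & forall t, f (c t) = c (t + a).

Definition bounds_flat_half_plane X (c : R -> X) :=
  exists h : plane R -> X,
    (forall p q : plane R, 0 <= p.2 -> 0 <= q.2 ->
       mdist (h p) (h q) = mdist p q) /\
    h @` [set p | p.2 = 0] = range c.

Definition rank1_isometry X (f : X -> X) :=
  is_isometry f /\
  exists c : R -> X, axis f c /\ ~ bounds_flat_half_plane c.

End CAT0.

Record isometric_action {R : realType} (G : groupType) (X : metricType R) :=
  IsometricAction {
    act_fun :> G -> X -> X ;
    act_one : forall x, act_fun 1%g x = x ;
    act_mul : forall g h x, act_fun (g * h)%g x = act_fun g (act_fun h x) ;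
    act_isometry : forall g, is_isometry (act_fun g)
  }.

Section Actions.
Context {R : realType} {G : groupType}.
Implicit Type X : metricType R.

Definition proper_action X (a : isometric_action G X) :=
  forall K : set X, compact K ->
    finite_set [set g : G | (a g @` K) `&` K !=set0].

Definition has_rank1_isometries X (a : isometric_action G X) :=
  exists g : G, rank1_isometry (a g).

Definition convex_cocompact X (a : isometric_action G X) :=
  exists C : set X,
    [/\ C !=set0, closed C, geodesically_convex C,
        forall g x, C x -> C (a g x) &
        exists K : set X,
          [/\ compact K, K `<=` C & C `<=` \bigcup_g (a g @` K)]].

Definition translation_length X (a : isometric_action G X) (g : G) : R :=
  inf (range (fun x : X => mdist x (a g x))).

Definition same_length_spectrum_up_to_rescaling (X1 X2 : metricType R)
    (a1 : isometric_action G X1) (a2 : isometric_action G X2) :=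
  exists2 lambda : R, 0 < lambda &
    forall g, translation_length a1 g = lambda * translation_length a2 g.

Section Diagonal.
Context {X1 X2 : metricType R}.
Variables (a1 : isometric_action G X1) (a2 : isometric_action G X2).

Let diag (g : G) (p : l2prod X1 X2) : l2prod X1 X2 := (a1 g p.1, a2 g p.2).

Let diag1 p : diag 1%g p = p.
Proof. by case: p => p1 p2; rewrite /diag /= !act_one. Qed.

Let diagM g h p : diag (g * h)%g p = diag g (diag h p).
Proof. by rewrite /diag /= !act_mul. Qed.

Let diag_isometry g : is_isometry (diag g).
Proof.
split=> [|p q].
  by exists (diag g^-1%g) => p; rewrite -diagM ?mulVg ?mulgV diag1.
by rewrite !mdist_l2prodE /= (act_isometry a1 g).2 (act_isometry a2 g).2.
Qed.

Definition diagonal_action : isometric_action G (l2prod X1 X2) :=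
  IsometricAction diag1 diagM diag_isometry.

End Diagonal.

End Actions.

(* Main.v *)
(* Let [h] act on [X1] as a rank-1 isometry with axis [c].  There is a [D] such
   that every point [p] is joined to [c t] or to [c (- t)] by a geodesic passing
   within [D] of [c 0]: otherwise one extracts a ray issuing from [c 0] which
   makes with [c] an angle at infinity strictly between [0] and [pi], and
   translating it along [c] by powers of [h] gives in the limit a flat half-plane
   bounded by [c].
   Take [o] in the convex cocompact set [C] and any [g].  The geodesic of [C] from
   [g^n o] to [h^n o] or [h^-n o] thus has a point [w] whose first coordinate is
   close to that of [o].  By cocompactness on [C] and properness on [X1], the
   second coordinates are then close too.  Since [w] sits at the same fraction of
   the geodesic in both factors, the ratio [d(o, g^n o) / d(o, h^n o)] is
   asymptotically the same in [X1] and in [X2], so that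
   [l1(g) l2(h) = l2(g) l1(h)]. *)

Require Import Defs.
From mathcomp Require Import all_boot all_order all_algebra.
From mathcomp Require Import all_classical all_reals all_analysis.
From mathcomp Require Import ring lra.

Set Implicit Arguments.
Unset Strict Implicit.
Unset Printing Implicit Defensive.

Import Order.TTheory GRing.Theory Num.Theory.
Import numFieldNormedType.Exports.

Local Open Scope classical_set_scope.
Local Open Scope ring_scope.

(** All that is drawn from CAT(0) is the existence of geodesics and Stewart's inequality; angles are
    comparison angles, handled as laws of cosines on squared distances, and no boundary at infinity
    is built. Rigidity is detected by one mechanism: when upper bounds at two points symmetric about
    a third add up to exactly what Stewart's inequality demands at the midpoint, both are
    equalities. The obstacle is that a ray extracted by compactness satisfies only inequalities, its
    comparison angles with [c] increasing with the distance. Moving the base point far along [c],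
    and aiming at points of the ray that are much farther still, replaces all of them by the
    limiting angle: the new ray makes that angle with one half of [c] and its supplement with the
    other, which is the equality case. The limiting angle must stay away from [0] and [pi]. This is
    arranged by picking, on a geodesic that avoids a large ball, a point whose direction lies at
    distance exactly [1/2] from that of the axis on the unit sphere; the cosines [7/8] and [-15/16]
    come from there. *)

Section RealLine.
Context {R : realType}.

Lemma mdist_realE (x y : R^o) : mdist x y = `|x - y|.
Proof.
apply/eqP; rewrite eq_le; apply/andP; split; apply/ler_addgt0Pr => e e0.
  have : ball x (`|x - y| + e) y by rewrite -ball_normE /ball_ /= ltrDl.
  by rewrite ballEmdist /= => /ltW.
have : ball x (mdist x y + e) y by rewrite ballEmdist /= ltrDl.
by rewrite -ball_normE /ball_ /= => /ltW.
Qed.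

Lemma plane_mdistE (p q : plane R) :
  mdist p q = Num.sqrt ((p.1 - q.1) ^+ 2 + (p.2 - q.2) ^+ 2).
Proof. by rewrite mdist_l2prodE !mdist_realE !real_normK ?num_real. Qed.

Lemma plane_mdist_sqr (p q : plane R) :
  mdist p q ^+ 2 = (p.1 - q.1) ^+ 2 + (p.2 - q.2) ^+ 2.
Proof. by rewrite plane_mdistE sqr_sqrtr// addr_ge0 ?sqr_ge0. Qed.

Definition plane_segment (p q : plane R) (s : R) : plane R :=
  (p.1 + s / mdist p q * (q.1 - p.1), p.2 + s / mdist p q * (q.2 - p.2)).

Lemma plane_segment_geodesic (p q : plane R) :
  geodesic_path p q (plane_segment p q).
Proof.
have [d0|d0] := eqVneq (mdist p q) 0.
  rewrite -(mdist_positivity _ _ d0); split; rewrite /plane_segment mdistxx.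
  - by rewrite !subrr !mulr0 !addr0; case: (p).
  - by rewrite !subrr !mulr0 !addr0; case: (p).
  move=> s t; rewrite !in_itv /= => /andP[s0 s1] /andP[t0 t1].
  rewrite !subrr !mulr0 !addr0 mdistxx.
  have -> : s = 0 by lra.
  have -> : t = 0 by lra.
  by rewrite subrr normr0.
rewrite /plane_segment; split.
- by rewrite !mul0r !addr0; case: (p).
- by rewrite divff// !mul1r !subrKC; case: (q).
move=> s t _ _; apply: (pexpIrn (n := 2)) => //; rewrite ?nnegrE ?mdist_ge0//.
rewrite plane_mdist_sqr /= real_normK ?num_real//.
transitivity (((s - t) / mdist p q) ^+ 2 * mdist p q ^+ 2).
  by rewrite [in RHS]plane_mdist_sqr; ring.
by field.
Qed.

End RealLine.

(** * Geodesics in CAT(0) spaces *)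

Section CAT0Geometry.
Context {R : realType} {X : metricType R}.
Implicit Types o p q x y z : X.

(* The point at fraction [t] of a chosen geodesic from [x] to [y]; the default
   [x] is only met when there is none. *)
Definition geo x y (t : R) : X :=
  xget (fun=> x) [set c : R -> X | geodesic_path x y c] (t * mdist x y).


Hypothesis HX : cat0_space X.

Lemma geo_path x y : geodesic_path x y (fun s => geo x y (s / mdist x y)).
Proof.
have [c hc] := HX.1 x y.
have [c0 c1 cd] : geodesic_path x y
    (xget (fun=> x) [set c : R -> X | geodesic_path x y c]).
  exact: (@xgetI _ (fun=> x) [set c : R -> X | geodesic_path x y c] c hc).
have [d0|d0] := eqVneq (mdist x y) 0.
  have e := mdist_positivity _ _ d0; subst y; rewrite /geo mdistxx in c0 c1 cd *.
  split; rewrite ?mul0r ?mulr0// => s t si ti.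
  rewrite !mulr0 c0 mdistxx; move: si ti; rewrite !in_itv /=.
  move=> /andP[s0 s1] /andP[t0 t1].
  have -> : s = 0 by lra.
  have -> : t = 0 by lra.
  by rewrite subrr normr0.
rewrite /geo; split; first by rewrite !mul0r.
  by rewrite divff// mul1r.
by move=> s t si ti; rewrite !divfK//; exact: cd.
Qed.

Lemma geo0 x y : geo x y 0 = x.
Proof. by have [+ _ _] := geo_path x y; rewrite /= mul0r. Qed.

Lemma geo1 x y : geo x y 1 = y.
Proof.
have [d0|d0] := eqVneq (mdist x y) 0.
  by have [_ + _] := geo_path x y; rewrite /= {1 2}/geo d0 !mulr0.
by have [_ + _] := geo_path x y; rewrite /= divff.
Qed.

Lemma geo_mdist x y (s t : R) : 0 <= s <= 1 -> 0 <= t <= 1 ->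
  mdist (geo x y s) (geo x y t) = `|s - t| * mdist x y.
Proof.
move=> /andP[s0 s1] /andP[t0 t1]; have d0 := mdist_ge0 x y.
have [e|dn0] := eqVneq (mdist x y) 0.
  by rewrite /geo e !mulr0 mdistxx.
have [_ _ /(_ (s * mdist x y) (t * mdist x y))] := geo_path x y.
rewrite !mulfK// -mulrBl normrM (ger0_norm d0); apply.
  by rewrite in_itv /= mulr_ge0//= ler_piMl.
by rewrite in_itv /= mulr_ge0//= ler_piMl.
Qed.

Lemma geo_mdistl x y (t : R) : 0 <= t <= 1 ->
  mdist x (geo x y t) = t * mdist x y.
Proof.
move=> t01; rewrite -{1}(geo0 x y) geo_mdist// ?lexx ?ler01//.
by rewrite sub0r normrN ger0_norm//; case/andP: t01.
Qed.

Lemma geo_mdistr x y (t : R) : 0 <= t <= 1 ->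
  mdist (geo x y t) y = (1 - t) * mdist x y.
Proof.
move=> t01; rewrite -{2}(geo1 x y) geo_mdist// ?lexx ?ler01//.
by rewrite distrC ger0_norm// subr_ge0; case/andP: t01.
Qed.

(** In the comparison triangle this is Stewart's theorem, an equality; CAT(0) only shortens the
    segment from [p] to the opposite side. *)
Lemma cat0_stewart p x y (t : R) : 0 <= t <= 1 ->
  mdist p (geo x y t) ^+ 2 <= (1 - t) * mdist p x ^+ 2 + t * mdist p y ^+ 2 -
    t * (1 - t) * mdist x y ^+ 2.
Proof.
move=> /andP[t0 t1].
set a := mdist p x; set b := mdist p y; set d := mdist x y.
have a0 : 0 <= a by exact: mdist_ge0.
have b0 : 0 <= b by exact: mdist_ge0.
have dge0 : 0 <= d by exact: mdist_ge0.
have [d0|dn0] := eqVneq d 0.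
  have e := mdist_positivity _ _ d0.
  have -> : geo x y t = x.
    by apply/esym/mdist_positivity; rewrite geo_mdistl ?t0// -/d d0 mulr0.
  by rewrite /b -e d0 expr0n /= mulr0 subr0 -mulrDl subrK mul1r.
have dgt0 : 0 < d by rewrite lt_neqAle eq_sym dn0.
have tr1 : b <= a + d by exact: metric_triangle.
have tr2 : a <= b + d.
  by rewrite /a /d (metric_sym x); exact: metric_triangle.
have tr3 : d <= a + b by rewrite /a (metric_sym p); exact: metric_triangle.
(* Abscissa of the apex by the law of cosines, the base lying on the horizontal axis. The triangle
   inequalities give [al ^+ 2 <= a ^+ 2], so that an ordinate [be] exists. *)
pose al := (d ^+ 2 + a ^+ 2 - b ^+ 2) / (2 * d).
have alE : 2 * d * al = d ^+ 2 + a ^+ 2 - b ^+ 2.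
  by rewrite /al mulrC divfK// mulf_neq0// pnatr_eq0.
have al_le : 0 <= a ^+ 2 - al ^+ 2.
  have h1 : 0 <= (2 * d * (a - al)).
    by rewrite mulrBr alE; nra.
  have h2 : 0 <= (2 * d * (a + al)).
    by rewrite mulrDr alE; nra.
  have d2 : 0 < 2 * d by lra.
  rewrite pmulr_rge0// in h1; rewrite pmulr_rge0// in h2.
  by rewrite subr_sqr mulr_ge0.
pose be := Num.sqrt (a ^+ 2 - al ^+ 2).
have beE : be ^+ 2 = a ^+ 2 - al ^+ 2 by rewrite sqr_sqrtr.
pose v (i : 'I_3) : X := match val i with 0 => x | 1 => y | _ => p end.
pose c (i : 'I_3) (s : R) : X :=
  geo (v i) (v (ordS i)) (s / mdist (v i) (v (ordS i))).
pose x' : plane R := (0, 0).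
pose y' : plane R := (d, 0).
pose p' : plane R := (al, be).
pose v' (i : 'I_3) : plane R := match val i with 0 => x' | 1 => y' | _ => p' end.
pose c' (i : 'I_3) := plane_segment (v' i) (v' (ordS i)).
have dxy : mdist x' y' = d.
  by rewrite plane_mdistE /= subrr expr0n addr0 sub0r sqrrN sqrtr_sqr ger0_norm.
have dxp : mdist x' p' = a.
  rewrite plane_mdistE /= !sub0r !sqrrN beE.
  by rewrite [X in Num.sqrt X](_ : _ = a ^+ 2) ?sqrtr_sqr ?ger0_norm//; ring.
have dyp : mdist y' p' = b.
  rewrite plane_mdistE /= sub0r sqrrN beE.
  rewrite [X in Num.sqrt X](_ : _ = b ^+ 2) ?sqrtr_sqr ?ger0_norm//.
  rewrite sqrrB; have -> : d * al *+ 2 = 2 * d * al by ring.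
  by rewrite alE; ring.
have vv (i j : 'I_3) : mdist (v' i) (v' j) = mdist (v i) (v j).
  case: i j => [[|[|[|//]]] hi] [[|[|[|//]]] hj] /=;
    rewrite /v /v' /= ?mdistxx ?dxy ?dxp ?dyp//.
  - by rewrite metric_sym.
  - by rewrite metric_sym dxy metric_sym.
  - by rewrite metric_sym.
  - by rewrite metric_sym dxp.
  - by rewrite metric_sym dyp.
(* Here [p] is seen as the point of parameter 0 on side 2, which runs from [p] to [x]. *)
have := HX.2 v c v' c' (fun i => geo_path _ _)
  (fun i => plane_segment_geodesic _ _) vv (@Ordinal 3 0 isT)
  (@Ordinal 3 2 isT) (t * d) 0.
have -> : c (@Ordinal 3 0 isT) (t * d) = geo x y t.
  by rewrite /c /v /= mulfK.
have -> : c (@Ordinal 3 2 isT) 0 = p by rewrite /c mul0r geo0.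
have -> : c' (@Ordinal 3 0 isT) (t * d) = (t * d, 0) :> plane R.
  by rewrite /c' /plane_segment /v' /= dxy mulfK// !add0r subr0 oppr0 mulr0.
have -> : c' (@Ordinal 3 2 isT) 0 = p'.
  by rewrite /c' /plane_segment !mul0r !addr0.
have -> : v (@Ordinal 3 0 isT) = x by [].
have -> : v (ordS (@Ordinal 3 0 isT)) = y by [].
rewrite -/d !in_itv /= mulr_ge0//= ler_piMl// lexx mdist_ge0 => /(_ isT isT).
rewrite -ler_sqr ?nnegrE ?mdist_ge0// plane_mdist_sqr /=.
rewrite sub0r sqrrN beE metric_sym => /le_trans; apply.
have -> : (t * d - al) ^+ 2 + (a ^+ 2 - al ^+ 2) =
   (t * d) ^+ 2 + a ^+ 2 - t * (2 * d * al) by ring.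
by rewrite alE le_eqVlt; apply/orP; left; apply/eqP; ring.
Qed.

(** With these two distances the right side of Stewart's inequality at [z] vanishes. *)
Lemma geo_uniq x y z (t : R) : 0 <= t <= 1 ->
  mdist x z = t * mdist x y -> mdist z y = (1 - t) * mdist x y ->
  z = geo x y t.
Proof.
move=> t01 xz zy; apply: mdist_positivity; apply/eqP.
rewrite -sqrf_eq0 eq_le sqr_ge0 andbT (le_trans (cat0_stewart z _ _ t01))//.
rewrite (metric_sym z x) xz zy le_eqVlt; apply/orP; left; apply/eqP; ring.
Qed.

Lemma geo_sym x y (t : R) : 0 <= t <= 1 -> geo y x t = geo x y (1 - t).
Proof.
move=> t01; have t01' : 0 <= 1 - t <= 1 by lra.
apply: geo_uniq => //.
  by rewrite metric_sym geo_mdistr// metric_sym.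
by rewrite metric_sym geo_mdistl// metric_sym; ring.
Qed.

(** Stewart's inequality twice. The right side is the law of cosines with the comparison angle of
    the large triangle at [o]: that angle does not increase when the sides are shortened. *)
Lemma cat0_comparison o p q (s t : R) : 0 <= s <= 1 -> 0 <= t <= 1 ->
  mdist (geo o p s) (geo o q t) ^+ 2 <=
  s ^+ 2 * mdist o p ^+ 2 + t ^+ 2 * mdist o q ^+ 2 -
    s * t * (mdist o p ^+ 2 + mdist o q ^+ 2 - mdist p q ^+ 2).
Proof.
move=> s01 t01; have /andP[s0 s1] := s01.
rewrite metric_sym (le_trans (cat0_stewart _ _ _ s01))//.
rewrite [mdist _ o]metric_sym geo_mdistl// [mdist _ p]metric_sym.
have := ler_wpM2l s0 (cat0_stewart p o q t01).
rewrite (metric_sym p o) => h.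
by apply: le_trans (lerB (lerD (lexx _) h) (lexx _)) _; rewrite le_eqVlt;
  apply/orP; left; apply/eqP; ring.
Qed.

Lemma geo_ratio o p q (t : R) : 0 <= t <= 1 ->
  mdist (geo o p t) (geo o q t) <= t * mdist p q.
Proof.
move=> t01; have /andP[t0 _] := t01.
rewrite -ler_sqr ?nnegrE ?mulr_ge0 ?mdist_ge0//.
apply: le_trans (cat0_comparison o p q t01 t01) _.
by rewrite le_eqVlt; apply/orP; left; apply/eqP; ring.
Qed.

Lemma geo_convex x y x' y' (t : R) : 0 <= t <= 1 ->
  mdist (geo x y t) (geo x' y' t) <=
  (1 - t) * mdist x x' + t * mdist y y'.
Proof.
move=> t01; have t01' : 0 <= 1 - t <= 1 by lra.
apply: le_trans (metric_triangle _ (geo x y' t) _) _.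
rewrite addrC lerD//; last exact: geo_ratio.
have -> : geo x y' t = geo y' x (1 - t) by rewrite geo_sym// subKr.
have -> : geo x' y' t = geo y' x' (1 - t) by rewrite geo_sym// subKr.
exact: geo_ratio.
Qed.

End CAT0Geometry.

(** * Limits along a free ultrafilter *)

(** One free ultrafilter serves for all limits at once, so points indexed by real parameters have
    compatible limits without any diagonal extraction. *)
Lemma free_ultrafilter_exists :
  exists U : set_system nat, UltraFilter U /\ \oo `<=` U.
Proof. exact: ultraFilterLemma. Qed.

Definition ufilter : set_system nat := sval (cid free_ultrafilter_exists).

#[export] Instance ufilter_ultra : UltraFilter ufilter.
Proof. exact: (svalP (cid free_ultrafilter_exists)).1. Qed.

#[export] Instance ufilter_proper : ProperFilter ufilter.
Proof. exact: ultra_proper. Qed.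

Lemma near_ufilter (P : set nat) :
  (\forall n \near \oo, P n) -> \forall n \near ufilter, P n.
Proof. exact: (svalP (cid free_ultrafilter_exists)).2. Qed.

Lemma cvg_ufilter (T : topologicalType) (u : nat -> T) (l : T) :
  u n @[n --> \oo] --> l -> u n @[n --> ufilter] --> l.
Proof. by move=> h A /h; exact: near_ufilter. Qed.

Section UltraLimit.
Context {R : realType}.

Lemma cvg_mdist (T : Type) (X : metricType R) (F : set_system T) (FF : Filter F)
    (x y : T -> X) (l m : X) :
  x n @[n --> F] --> l -> y n @[n --> F] --> m ->
  mdist (x n) (y n) @[n --> F] --> mdist l m.
Proof.
move=> xl ym; apply/cvgrPdist_le => e e0; have e2 : 0 < e / 2 by lra.
have hx := metricType_numDomainType.cvgr_dist_le xl e2.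
have hy := metricType_numDomainType.cvgr_dist_le ym e2.
near=> n.
have h1 : mdist l (x n) <= e / 2 by near: n; exact: hx.
have h2 : mdist m (y n) <= e / 2 by near: n; exact: hy.
have := metric_triangle l (x n) m; have := metric_triangle (x n) (y n) m.
have := metric_triangle (x n) l (y n); have := metric_triangle l m (y n).
rewrite (metric_sym (y n) m) (metric_sym (x n) l) => *.
by rewrite ler_norml; apply/andP; split; lra.
Unshelve. all: by end_near. Qed.

Context {X : metricType R}.
Hypothesis pX : proper_space X.

Definition ubounded (x : nat -> X) :=
  exists o r, \forall n \near ufilter, mdist o (x n) <= r.

Definition ulim (x : nat -> X) : X :=
  xget (x 0%N) [set l | x n @[n --> ufilter] --> l].

Lemma ulim_cvg (x : nat -> X) : ubounded x -> x n @[n --> ufilter] --> ulim x.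
Proof.
case=> o [r xr]; have := @pX o r; rewrite compact_ultra.
have uU : UltraFilter (x n @[n --> ufilter]).
  split; first exact: fmap_proper_filter.
  move=> G propG subG; apply/seteqP; split=> // A GA.
  have [//|UA] := in_ultra_setVsetC (x @^-1` A) ufilter_ultra.
  have /subG GCA : (x n @[n --> ufilter]) (~` A) by [].
  have : G (A `&` ~` A) by exact: filterI.
  by rewrite setICr => /filter_not_empty.
move=> /(_ _ uU xr) [l [_ xl]].
exact: (@xgetI _ (x 0%N) [set l | x n @[n --> ufilter] --> l] l xl).
Qed.

Lemma ubounded_cst (c : X) : ubounded (fun=> c).
Proof. by exists c, 0; near=> n; rewrite mdistxx.
Unshelve. all: by end_near. Qed.

Lemma ulim_cst (c : X) : ulim (fun=> c) = c.
Proof.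
apply: (cvg_unique (@metric_hausdorff _ X) (ulim_cvg (ubounded_cst c))).
exact: cvg_cst.
Qed.

Lemma ulim_mdist (x y : nat -> X) : ubounded x -> ubounded y ->
  mdist (x n) (y n) @[n --> ufilter] --> mdist (ulim x) (ulim y).
Proof. by move=> bx bY; apply: cvg_mdist; exact: ulim_cvg. Qed.

Lemma ulim_mdist_eq (x y : nat -> X) (a : nat -> R) (l : R) :
  ubounded x -> ubounded y -> a n @[n --> ufilter] --> l ->
  (\forall n \near ufilter, mdist (x n) (y n) = a n) ->
  mdist (ulim x) (ulim y) = l.
Proof.
move=> bx bY al xya; have cv := ulim_mdist bx bY.
apply/eqP; rewrite eq_le; apply/andP; split.
  by apply: (ler_cvg_to cv al); apply: filterS xya => n ->.
by apply: (ler_cvg_to al cv); apply: filterS xya => n ->.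
Qed.

Lemma ulim_sqr_mdist_le (x y : nat -> X) (a : nat -> R) (l : R) :
  ubounded x -> ubounded y -> a n @[n --> ufilter] --> l ->
  (\forall n \near ufilter, mdist (x n) (y n) ^+ 2 <= a n) ->
  mdist (ulim x) (ulim y) ^+ 2 <= l.
Proof.
move=> bx bY al xya; have cv := ulim_mdist bx bY.
exact: (ler_cvg_to (cvgM cv cv) al).
Qed.

Lemma ulim_sqr_mdist_eq (x y : nat -> X) (a : nat -> R) (l : R) :
  ubounded x -> ubounded y -> a n @[n --> ufilter] --> l ->
  (\forall n \near ufilter, mdist (x n) (y n) ^+ 2 = a n) ->
  mdist (ulim x) (ulim y) ^+ 2 = l.
Proof.
move=> bx bY al xya; have cv := ulim_mdist bx bY.
apply/eqP; rewrite eq_le; apply/andP; split.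
  by apply: ulim_sqr_mdist_le al _ => //; apply: filterS xya => n ->.
by apply: (ler_cvg_to al (cvgM cv cv)); apply: filterS xya => n <-.
Qed.

End UltraLimit.

(** * Flat half-planes *)

Lemma cvg_divnD {R : realType} (k b : R) :
  k / (n%:R + b) @[n --> ufilter] --> (0 : R).
Proof.
apply: cvg_ufilter; apply/cvgrPdist_le => e e0.
have k0 := normr_ge0 k.
near=> n.
have hn : `|k| / e + 1 - b <= n%:R by near: n; exact: nbhs_infty_ger.
have h0 : 0 <= `|k| / e by rewrite divr_ge0// ltW.
have d0 : 0 < n%:R + b by lra.
rewrite sub0r normrN normrM normfV (gtr0_norm d0) ler_pdivrMr//.
rewrite mulrC -ler_pdivrMr//; lra.
Unshelve. all: by end_near. Qed.

Lemma ge0_sqr_inj {R : realType} (x y : R) :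
  0 <= x -> 0 <= y -> x ^+ 2 = y ^+ 2 -> x = y.
Proof. by move=> x0 y0 /eqP; rewrite eqrXn2// => /eqP. Qed.

(** Turns a bound on a squared distance into a bound on the distance without a square root. *)
Lemma le_1Dsqr {R : realType} (x : R) : x <= 1 + x ^+ 2.
Proof. by have := sqr_ge0 (x - 2^-1); rewrite sqrrB; lra. Qed.

Section Lines.
Context {R : realType} {X : metricType R}.
Hypothesis HX : cat0_space X.

Lemma geodesic_line_geo (c : R -> X) (a b t : R) : geodesic_line c ->
  0 <= t <= 1 -> c ((1 - t) * a + t * b) = geo (c a) (c b) t.
Proof.
move=> hc t01; have /andP[t0 t1] := t01; apply: geo_uniq => //; rewrite !hc.
  have -> : a - ((1 - t) * a + t * b) = t * (a - b) by ring.
  by rewrite normrM (ger0_norm t0).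
have -> : (1 - t) * a + t * b - b = (1 - t) * (a - b) by ring.
by rewrite normrM (ger0_norm (x := 1 - t))// subr_ge0.
Qed.

Lemma ray_geo (r : R -> X) (u v : R) :
  (forall u v : R, 0 <= u -> 0 <= v -> mdist (r u) (r v) = `|u - v|) ->
  0 <= v <= u -> 0 < u -> r v = geo (r 0) (r u) (v / u).
Proof.
move=> rd /andP[v0 vu] u0; apply: geo_uniq => //; rewrite ?rd ?(ltW u0)//.
- by rewrite divr_ge0 ?(ltW u0)//= ler_pdivrMr// mul1r.
- by rewrite !sub0r !normrN !ger0_norm ?(ltW u0)// divfK// gt_eqF.
- rewrite sub0r normrN (gtr0_norm u0) distrC ger0_norm ?subr_ge0//.
  by field; rewrite gt_eqF.
Qed.

(* The distance is convex, and a bounded convex function on the whole real line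
   is constant. *)
Lemma parallel_mdist (c c' : R -> X) (M : R) :
  geodesic_line c -> geodesic_line c' ->
  (forall t, mdist (c t) (c' t) <= M) ->
  forall s t, mdist (c s) (c' s) = mdist (c t) (c' t).
Proof.
move=> hc hc' bd.
suff le s t : mdist (c t) (c' t) <= mdist (c s) (c' s).
  by move=> s t; apply/eqP; rewrite eq_le !le.
apply/ler_addgt0Pr => e e0.
have M0 : 0 <= M by rewrite (le_trans _ (bd 0))// mdist_ge0.
have Me : 0 <= M / e by rewrite divr_ge0// ltW.
(* [t] lies at fraction [k] between [s] and a remote parameter, whose weight in the convexity
   inequality is at most [k * M <= e]. *)
pose k := (1 + M / e)^-1.
have k01 : 0 <= k <= 1 by rewrite invr_ge0 invf_le1; lra.
have kM : k * M <= e.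
  rewrite /k mulrC ler_pdivrMr; last lra.
  by rewrite mulrDr mulrCA mulfV ?lt0r_neq0//; lra.
have knz : k != 0 by rewrite invr_neq0// lt0r_neq0//; lra.
have tE : t = (1 - k) * s + k * (s + (t - s) / k).
  by field.
rewrite {1 2}tE !geodesic_line_geo//.
apply: le_trans (geo_convex HX _ _ _ _ k01) _.
have := ler_wpM2l (andP k01).1 (bd (s + (t - s) / k)).
have := mulr_ge0 (andP k01).1 (mdist_ge0 (c s) (c' s)); lra.
Qed.

(* A midpoint convex function which is nonpositive and vanishes at [S = T] is
   zero; this upgrades Stewart's inequality to an equality for all [S]. *)
Lemma flat_point_geo (c : R -> X) (p : X) (x y2 T f : R) :
  geodesic_line c -> 0 <= f <= 1 ->
  (forall S, mdist p (c S) ^+ 2 = (S - x) ^+ 2 + y2) ->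
  forall S, mdist (geo p (c T) f) (c S) ^+ 2 =
    (S - (x + f * (T - x))) ^+ 2 + (1 - f) ^+ 2 * y2.
Proof.
move=> hc f01 hp.
have sqd a b : mdist (c a) (c b) ^+ 2 = (a - b) ^+ 2.
  by rewrite hc real_normK// num_real.
have le S : mdist (geo p (c T) f) (c S) ^+ 2 <=
    (S - (x + f * (T - x))) ^+ 2 + (1 - f) ^+ 2 * y2.
  rewrite metric_sym (le_trans (cat0_stewart HX _ _ _ f01))//.
  rewrite (metric_sym (c S) p) !hp sqd le_eqVlt; apply/orP; left.
  by apply/eqP; ring.
move=> S; apply/eqP; rewrite eq_le le /=.
have h2 : 0 <= (2^-1 : R) <= 1 by lra.
have := cat0_stewart HX (geo p (c T) f) (c S) (c (2 * T - S)) h2.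
rewrite -geodesic_line_geo//.
have -> : (1 - 2^-1) * S + 2^-1 * (2 * T - S) = T by field.
rewrite geo_mdistr// exprMn hp sqd.
have := le (2 * T - S); lra.
Qed.

End Lines.

(** * The half-plane spanned by a line and a ray at Euclidean distances from it *)

Section FlatHalfPlane.
Context {R : realType} {X : metricType R}.
Hypotheses (HX : cat0_space X) (pX : proper_space X).
Variables (c r : R -> X) (C : R).
Hypotheses (hc : geodesic_line c) (C1 : C ^+ 2 < 1) (r0 : r 0 = c 0).
Hypothesis rd : forall u v : R, 0 <= u -> 0 <= v -> mdist (r u) (r v) = `|u - v|.
Hypothesis rc : forall u T : R, 0 <= u ->
  mdist (r u) (c T) ^+ 2 = (T - u * C) ^+ 2 + u ^+ 2 * (1 - C ^+ 2).

Let C2 : 0 <= 1 - C ^+ 2.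
Proof. by rewrite subr_ge0 ltW. Qed.

(** The end of [c] to aim at for a displacement [s]. The value at [s = 0] is immaterial, [fr u 0 n]
    being 0. *)
Let sg (s : R) : R := if 0 <= s then 1 else -1.
(* The fraction of the segment from [r u] to [c (sg s * n)] at which the
   coordinate along [c] has changed by exactly [s]. *)
Let fr (u s : R) (n : nat) : R := s / (sg s * n%:R - u * C).
Let approx (u s : R) (n : nat) : X := geo (r u) (c (sg s * n%:R)) (fr u s n).

(* The line through [r u] parallel to [c]. *)
Let L (u s : R) : X := ulim (approx u s).

Let fr_cvg (u s : R) : fr u s n @[n --> ufilter] --> (0 : R).
Proof.
rewrite /fr /sg; case: ifP => _.
  by under eq_fun do rewrite mul1r; exact: cvg_divnD.
have -> : (fun n : nat => s / (-1 * n%:R - u * C)) =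
          (fun n => (- s) / (n%:R + u * C)).
  apply/funext => n; rewrite mulN1r -opprD -(opprK (n%:R + _)) invrN opprK.
  by rewrite mulrN mulNr.
exact: cvg_divnD.
Qed.

Let fr01 (u s : R) : \forall n \near ufilter, 0 <= fr u s n <= 1.
Proof.
near=> n.
have hn : `|s| + `|u * C| + 1 <= n%:R.
  by near: n; apply: near_ufilter; exact: nbhs_infty_ger.
have := ler_norm (u * C); have := ler_norm (- (u * C)); rewrite normrN => h1 h2.
rewrite /fr /sg; have [s0|s0] := leP 0 s.
  rewrite (ger0_norm s0) in hn.
  have d0 : 0 < 1 * n%:R - u * C by lra.
  by rewrite divr_ge0 ?ler_pdivrMr//=; lra.
rewrite (ltr0_norm s0) in hn.
rewrite mulN1r -opprD -[X in X / _]opprK invrN mulrNN.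
have d0 : 0 < n%:R + u * C by lra.
by rewrite divr_ge0 ?ler_pdivrMr//=; lra.
Unshelve. all: by end_near. Qed.

Let fr_mul (u s : R) : \forall n \near ufilter, fr u s n * (sg s * n%:R - u * C) = s.
Proof.
near=> n.
have hn : `|u * C| + 1 <= n%:R.
  by near: n; apply: near_ufilter; exact: nbhs_infty_ger.
have := ler_norm (u * C); have := ler_norm (- (u * C)); rewrite normrN => h1 h2.
rewrite /fr divfK// /sg; case: ifP => _; apply/eqP; lra.
Unshelve. all: by end_near. Qed.

(** For large [n] the abscissa along [c] is already the exact [u * C + s]; only the height is off,
    by the factor [1 - fr u s n], which tends to 1. *)
Let approxc (u s : R) : 0 <= u -> forall S : R, \forall n \near ufilter,
  mdist (approx u s n) (c S) ^+ 2 =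
  (S - (u * C + s)) ^+ 2 + (1 - fr u s n) ^+ 2 * (u ^+ 2 * (1 - C ^+ 2)).
Proof.
move=> u0 S; near=> n.
have f01 : 0 <= fr u s n <= 1 by near: n; exact: fr01.
have fm : fr u s n * (sg s * n%:R - u * C) = s by near: n; exact: fr_mul.
rewrite /approx (flat_point_geo HX (x := u * C) (y2 := u ^+ 2 * (1 - C ^+ 2)))//.
  by rewrite fm.
by move=> S'; rewrite rc.
Unshelve. all: by end_near. Qed.

Let approx_bounded (u s : R) : 0 <= u -> ubounded (approx u s).
Proof.
move=> u0; pose y2 := u ^+ 2 * (1 - C ^+ 2).
have y20 : 0 <= y2 by rewrite mulr_ge0 ?sqr_ge0.
exists (c 0), (1 + (u * C + s) ^+ 2 + y2); near=> n.
have f01 : 0 <= fr u s n <= 1 by near: n; exact: fr01.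
have : mdist (approx u s n) (c 0) ^+ 2 =
  (0 - (u * C + s)) ^+ 2 + (1 - fr u s n) ^+ 2 * y2 by near: n; exact: approxc.
rewrite metric_sym sub0r sqrrN => e.
apply: le_trans (le_1Dsqr _) _; rewrite e addrA lerD2l.
by rewrite ler_piMl// exprn_ile1//; lra.
Unshelve. all: by end_near. Qed.

Let Lc (u s S : R) : 0 <= u ->
  mdist (L u s) (c S) ^+ 2 = (S - (u * C + s)) ^+ 2 + u ^+ 2 * (1 - C ^+ 2).
Proof.
move=> u0; rewrite -(ulim_cst pX (c S)).
apply: (ulim_sqr_mdist_eq pX _ _ _ (approxc s u0 S)).
- exact: approx_bounded.
- exact: ubounded_cst.
- apply: cvgD; first exact: cvg_cst.
  rewrite -[X in _ --> X]mul1r; apply: cvgM; last exact: cvg_cst.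
  have : (1 - fr u s n) @[n --> ufilter] --> (1 - 0 : R).
    by apply: cvgB (fr_cvg u s); exact: cvg_cst.
  by rewrite subr0 => h; rewrite -[X in _ --> X]mulr1; exact: cvgM.
Qed.

Let Lsame (u s t : R) : 0 <= u -> sg s = sg t -> mdist (L u s) (L u t) = `|s - t|.
Proof.
move=> u0 st; apply: ge0_sqr_inj; rewrite ?mdist_ge0//.
rewrite real_normK ?num_real//.
apply: (ulim_sqr_mdist_eq pX (approx_bounded s u0) (approx_bounded t u0)
  (a := fun n => (s - t) ^+ 2 +
     (fr u s n - fr u t n) ^+ 2 * (u ^+ 2 * (1 - C ^+ 2)))).
  rewrite -[X in _ --> X]addr0; apply: cvgD; first exact: cvg_cst.
  rewrite -[X in _ --> X](mul0r (u ^+ 2 * (1 - C ^+ 2))).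
  apply: cvgM; last exact: cvg_cst.
  have : (fr u s n - fr u t n) @[n --> ufilter] --> (0 - 0 : R).
    by apply: cvgB; exact: fr_cvg.
  by rewrite subr0 => h; rewrite -[X in _ --> X](mulr0 0); exact: cvgM.
near=> n.
have fs01 : 0 <= fr u s n <= 1 by near: n; exact: fr01.
have ft01 : 0 <= fr u t n <= 1 by near: n; exact: fr01.
have fs : fr u s n * (sg s * n%:R - u * C) = s by near: n; exact: fr_mul.
have ft : fr u t n * (sg t * n%:R - u * C) = t by near: n; exact: fr_mul.
rewrite /approx -st geo_mdist// exprMn real_normK ?num_real// rc//.
have -> : s - t = (fr u s n - fr u t n) * (sg s * n%:R - u * C).
  by rewrite mulrBl fs st ft.
by ring.
Unshelve. all: by end_near. Qed.

Let L0 (u : R) : 0 <= u -> L u 0 = r u.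
Proof.
move=> u0; rewrite -(ulim_cst pX (r u)) /L; congr ulim.
by apply/funext => n; rewrite /approx /fr mul0r geo0.
Qed.

Let Lr (u s : R) : 0 <= u -> mdist (L u s) (r u) = `|s|.
Proof.
move=> u0; apply: ge0_sqr_inj; rewrite ?mdist_ge0//.
rewrite real_normK ?num_real// -(ulim_cst pX (r u)).
apply: (ulim_sqr_mdist_eq pX (approx_bounded s u0) (ubounded_cst (r u))
  (a := fun n => s ^+ 2 + fr u s n ^+ 2 * (u ^+ 2 * (1 - C ^+ 2)))).
  rewrite -[X in _ --> X]addr0; apply: cvgD; first exact: cvg_cst.
  rewrite -[X in _ --> X](mul0r (u ^+ 2 * (1 - C ^+ 2))).
  apply: cvgM; last exact: cvg_cst.
  by rewrite -[X in _ --> X](mulr0 0); apply: cvgM; exact: fr_cvg.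
near=> n.
have fs01 : 0 <= fr u s n <= 1 by near: n; exact: fr01.
have fs : fr u s n * (sg s * n%:R - u * C) = s by near: n; exact: fr_mul.
rewrite /approx metric_sym geo_mdistl// exprMn rc//.
have -> : s ^+ 2 = (fr u s n * (sg s * n%:R - u * C)) ^+ 2 by rewrite fs.
by ring.
Unshelve. all: by end_near. Qed.

(** The two points are approximated on segments aimed at opposite ends of [c], so no common geodesic
    gives their distance. Instead, their distances to [c S] differ by nearly [s - t] as [S] tends to
    minus infinity, which forbids a shortcut. *)
Let Lopp (u s t : R) : 0 <= u -> t < 0 <= s -> mdist (L u s) (L u t) = s - t.
Proof.
move=> u0 /andP[t0 s0]; apply/eqP; rewrite eq_le; apply/andP; split.
  apply: le_trans (metric_triangle _ (r u) _) _.
  by rewrite (metric_sym (r u)) !Lr// ger0_norm// ltr0_norm.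
rewrite leNgt; apply/negP => lt.
pose D := mdist (L u s) (L u t); pose y2 := u ^+ 2 * (1 - C ^+ 2).
have y20 : 0 <= y2 by rewrite mulr_ge0 ?sqr_ge0.
have d0 : 0 < s - t - D by rewrite subr_gt0.
(* Large enough for [(w + (s - t - D)) ^+ 2] to exceed [w ^+ 2 + y2], the squared distance from
   [L u t] to [c S]. *)
pose w := (y2 + 1) / (s - t - D).
have w0 : 0 < w by rewrite divr_gt0//; lra.
have wE : w * (s - t - D) = y2 + 1 by rewrite divfK// gt_eqF.
pose S := - (w - u * C - t).
have := metric_triangle (L u s) (L u t) (c S); rewrite -/D => tri.
have := Lc s S u0; have := Lc t S u0; rewrite -/y2 /S => e1 e2.
have := mdist_ge0 (L u s) (c S); have := mdist_ge0 (L u t) (c S).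
rewrite /S in tri e1 e2 *; move: tri e1 e2.
set a := mdist (L u s) _; set b := mdist (L u t) _ => tri e1 e2 b0 a0.
have D0 : 0 <= D by exact: mdist_ge0.
have ea : a ^+ 2 = (w + (s - t)) ^+ 2 + y2 by rewrite e2; ring.
have eb : b ^+ 2 = w ^+ 2 + y2 by rewrite e1; ring.
have wa : w + (s - t) <= a.
  rewrite -ler_sqr ?nnegrE//; last lra.
  by rewrite ea lerDl.
have : (w + (s - t - D)) ^+ 2 <= b ^+ 2 by rewrite ler_sqr ?nnegrE//; lra.
rewrite eb sqrrD wE; have := sqr_ge0 (s - t - D); lra.
Qed.

Let L_line (u : R) : 0 <= u -> geodesic_line (L u).
Proof.
move=> u0 s t; have [s0|s0] := leP 0 s; have [t0|t0] := leP 0 t.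
- by apply: Lsame => //; rewrite /sg s0 t0.
- by rewrite Lopp ?t0// ger0_norm//; lra.
- by rewrite metric_sym Lopp ?t0 ?s0// distrC ger0_norm//; lra.
- by apply: Lsame => //; rewrite /sg !leNgt s0 t0.
Qed.

(** Stewart's inequality on the segment from [c 0] to [r u] bounds the left side from above.
    Equality holds because [L u s] and [L u (- s)] have midpoint [r u], at the known distance
    [u - v] from [r v]. *)
Let rL (u v s : R) : 0 <= v <= u ->
  mdist (r v) (L u s) ^+ 2 = (u - v) ^+ 2 + s ^+ 2 + 2 * s * (u - v) * C.
Proof.
move=> /andP[v0]; rewrite le_eqVlt => /predU1P[<-|vu].
  by rewrite metric_sym Lr// real_normK ?num_real//; ring.
have u0 : 0 < u by exact: le_lt_trans vu.
have f01 : 0 <= v / u <= 1.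
  by rewrite divr_ge0 ?(ltW u0)//= ler_pdivrMr// mul1r ltW.
have rE : r v = geo (c 0) (r u) (v / u).
  by rewrite -r0; apply: ray_geo; rewrite ?v0 ?ltW.
have le (t : R) : mdist (r v) (L u t) ^+ 2 <=
    (u - v) ^+ 2 + t ^+ 2 + 2 * t * (u - v) * C.
  rewrite {1}rE metric_sym (le_trans (cat0_stewart HX _ _ _ f01))//.
  rewrite Lc ?(ltW u0)// Lr ?(ltW u0)// -r0 rd ?(ltW u0)// !real_normK ?num_real//.
  by rewrite le_eqVlt; apply/orP; left; apply/eqP; field; rewrite gt_eqF.
apply/eqP; rewrite eq_le le /=.
have h2 : 0 <= (2^-1 : R) <= 1 by lra.
have := cat0_stewart HX (r v) (L u s) (L u (- s)) h2.
rewrite -geodesic_line_geo//; last exact/L_line/ltW.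
have -> : (1 - 2^-1) * s + 2^-1 * - s = 0 by field.
rewrite L0 ?(ltW u0)// rd ?(ltW u0)// L_line ?(ltW u0)//.
rewrite !real_normK ?num_real//.
have := le (- s); lra.
Qed.

(** Both lines stay at bounded distance from [c], so they are parallel and sliding along them
    preserves the distance; sliding by [- t] reduces to [L v 0 = r v]. *)
Let LL (u v s t : R) : 0 <= v <= u ->
  mdist (L u s) (L v t) ^+ 2 =
  (u - v) ^+ 2 + (s - t) ^+ 2 + 2 * (s - t) * (u - v) * C.
Proof.
move=> uv; have /andP[v0 vu] := uv; have u0 : 0 <= u by exact: le_trans vu.
have shift (a w : R) : 0 <= w -> geodesic_line (fun z => L w (a + z)).
  by move=> w0 x y; rewrite L_line//; congr `|_|; ring.
have hb (z : R) : mdist (L u (s + z)) (L v (t + z)) <=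
    (1 + u ^+ 2 * (1 - C ^+ 2)) + (1 + ((u * C + s) - (v * C + t)) ^+ 2 +
    v ^+ 2 * (1 - C ^+ 2)).
  apply: le_trans (metric_triangle _ (c (u * C + (s + z))) _) _.
  apply: lerD.
    have := Lc (s + z) (u * C + (s + z)) u0; rewrite subrr expr0n /= add0r.
    by move=> <-; exact: le_1Dsqr.
  rewrite metric_sym; have := Lc (t + z) (u * C + (s + z)) v0.
  have -> : u * C + (s + z) - (v * C + (t + z)) = u * C + s - (v * C + t) by ring.
  by rewrite -[X in _ <= X]addrA => <-; exact: le_1Dsqr.
have := parallel_mdist HX (shift s u u0) (shift t v v0) hb 0 (- t).
by rewrite !addr0 subrr L0// => ->; rewrite metric_sym rL.
Qed.

Lemma flat_half_plane_of_ray : bounds_flat_half_plane c.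
Proof.
have Cgt : 0 < 1 - C ^+ 2 by rewrite subr_gt0.
pose S := Num.sqrt (1 - C ^+ 2).
have S0 : 0 < S by rewrite sqrtr_gt0.
have SE : S ^+ 2 = 1 - C ^+ 2 by rewrite sqr_sqrtr// ltW.
(* Oblique coordinates: [r] has slope angle of cosine [C] and sine [S], so it reaches height [p.2]
   at time [p.2 / S], above the abscissa [p.2 / S * C]. *)
pose h (p : plane R) := L (p.2 / S) (p.1 - p.2 / S * C).
exists h; split.
  have main (p q : plane R) : 0 <= q.2 -> q.2 <= p.2 ->
      mdist (h p) (h q) = mdist p q.
    move=> q0 qp; apply: ge0_sqr_inj; rewrite ?mdist_ge0//.
    rewrite plane_mdist_sqr /h LL; last first.
      by rewrite divr_ge0 ?(ltW S0)//= ler_pM2r ?invr_gt0.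
    have -> : (p.2 - q.2) ^+ 2 = (p.2 / S - q.2 / S) ^+ 2 * S ^+ 2.
      by field; rewrite gt_eqF.
    by rewrite SE; ring.
  move=> p q p0 q0; have [qp|pq] := leP q.2 p.2; first exact: main.
  by rewrite metric_sym [RHS]metric_sym main// ltW.
have L0c s : L 0 s = c s.
  apply: mdist_positivity; apply/eqP; rewrite -sqrf_eq0 Lc//.
  by apply/eqP; ring.
apply/seteqP; split => x /=.
  by move=> [p /= p0 <-]; exists p.1 => //; rewrite /h p0 !mul0r subr0 L0c.
by move=> [t _ <-]; exists (t, 0) => //; rewrite /h /= !mul0r subr0 L0c.
Qed.

End FlatHalfPlane.

(** * Moving a ray along the axis until its angle with the axis becomes exact *)

Section Renormalization.
Context {R : realType} {X : metricType R}.
Hypotheses (HX : cat0_space X) (pX : proper_space X).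
Variables (c rho : R -> X) (phi : nat -> X -> X) (b : nat -> R).
Hypotheses (hc : geodesic_line c) (rho0 : rho 0 = c 0).
Hypothesis rhod : forall u v : R, 0 <= u -> 0 <= v ->
  mdist (rho u) (rho v) = `|u - v|.
Hypothesis rhoc : forall u T : R, 0 <= u -> 0 <= T ->
  mdist (rho u) (c T) ^+ 2 <= u ^+ 2 + T ^+ 2 + 15 / 8 * u * T.
Hypothesis rho1 : mdist (rho 1) (c 1) = 2^-1.
Hypothesis bk : forall k, k%:R <= b k.
Hypothesis phid : forall k x y, mdist (phi k x) (phi k y) = mdist x y.
Hypothesis phic : forall k t, phi k (c t) = c (t - b k).

(* The cosine of the comparison angle at [c 0] between [rho u] and [c T]. *)
Let ka (u T : R) : R :=
  (u ^+ 2 + T ^+ 2 - mdist (rho u) (c T) ^+ 2) / (2 * u * T).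

Let kaE (u T : R) : 0 < u -> 0 < T ->
  mdist (rho u) (c T) ^+ 2 = u ^+ 2 + T ^+ 2 - 2 * u * T * ka u T.
Proof. by move=> u0 T0; rewrite /ka; field; rewrite !gt_eqF. Qed.

Let angles : set R := [set k | exists u T, [/\ 0 < u, 0 < T & k = ka u T]].

(** Comparison angles at [c 0] grow with the distances, so this infimum is also a limit: the cosine
    of the angle at infinity between [rho] and the positive half of [c]. *)
Let C : R := inf angles.

Let angles_lb : lbound angles (- (15 / 16)).
Proof.
move=> _ [u [T [u0 T0 ->]]]; rewrite /ka ler_pdivlMr ?mulr_gt0//.
have := rhoc (ltW u0) (ltW T0); lra.
Qed.

Let ka11 : ka 1 1 = 7 / 8.
Proof. by rewrite /ka rho1; field. Qed.

Let angles_11 : angles (7 / 8).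
Proof. by exists 1, 1; split; rewrite ?ka11. Qed.

Let C_lt1 : C ^+ 2 < 1.
Proof.
have h1 : - (15 / 16) <= C.
  by apply: lb_le_inf angles_lb; exists (7 / 8).
have h2 : C <= 7 / 8 by apply: ge_inf angles_11; exists (- (15 / 16)).
by rewrite expr2; nra.
Qed.

Let le_C (u T : R) : 0 <= u -> 0 <= T ->
  mdist (rho u) (c T) ^+ 2 <= u ^+ 2 + T ^+ 2 - 2 * u * T * C.
Proof.
rewrite le_eqVlt => /predU1P[<- T0|u0].
  by rewrite rho0 hc real_normK ?num_real//; lra.
rewrite le_eqVlt => /predU1P[<-|T0].
  by rewrite -rho0 rhod ?(ltW u0)// subr0 real_normK ?num_real//; lra.
rewrite kaE// lerD2l lerN2 ler_pM2l ?mulr_gt0//.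
by apply: ge_inf; [exists (- (15 / 16))|exists u, T].
Qed.

Let ka_mono (u T u' T' : R) : 0 < u <= u' -> 0 < T <= T' -> ka u' T' <= ka u T.
Proof.
move=> /andP[u0 uu'] /andP[T0 TT'].
have u'0 : 0 < u' by exact: lt_le_trans uu'.
have T'0 : 0 < T' by exact: lt_le_trans TT'.
have cd (v w : R) : 0 <= v -> 0 <= w -> mdist (c v) (c w) = `|v - w| by [].
have eu : rho u = geo (c 0) (rho u') (u / u').
  by rewrite -rho0; apply: ray_geo; rewrite ?uu' ?(ltW u0).
have eT : c T = geo (c 0) (c T') (T / T').
  by apply: ray_geo; rewrite ?TT' ?(ltW T0).
have := cat0_comparison HX (c 0) (rho u') (c T') (s := u / u') (t := T / T').
have hs : 0 <= u / u' <= 1.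
  by rewrite divr_ge0 ?(ltW u0) ?(ltW u'0)//= ler_pdivrMr// mul1r.
have ht : 0 <= T / T' <= 1.
  by rewrite divr_ge0 ?(ltW T0) ?(ltW T'0)//= ler_pdivrMr// mul1r.
rewrite -eu -eT => /(_ hs ht).
rewrite !kaE// -rho0 rhod ?(ltW u'0)// rho0 hc !sub0r !normrN.
rewrite !real_normK ?num_real//.
have -> : (u / u') ^+ 2 * u' ^+ 2 + (T / T') ^+ 2 * T' ^+ 2 -
  u / u' * (T / T') * (u' ^+ 2 + T' ^+ 2 -
  (u' ^+ 2 + T' ^+ 2 - 2 * u' * T' * ka u' T')) =
  u ^+ 2 + T ^+ 2 - 2 * u * T * ka u' T'.
  by field; rewrite !gt_eqF.
by rewrite lerD2l lerN2 ler_pM2l ?mulr_gt0.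
Qed.

Let C_lim (e : R) : 0 < e -> exists M : R, forall u T : R, 0 < u -> 0 < T ->
  M <= u -> M <= T ->
  u ^+ 2 + T ^+ 2 - 2 * u * T * (C + e) <= mdist (rho u) (c T) ^+ 2.
Proof.
move=> e0; have hi : has_inf angles.
  by split; [exists (7 / 8)|exists (- (15 / 16))].
have [k [u0 [T0 [u00 T00 ->]]] lt] := inf_adherent e0 hi.
exists (Num.max u0 T0) => u T up Tp; rewrite !ge_max.
move=> /andP[u0u _] /andP[_ T0T].
rewrite kaE// lerD2l lerN2 ler_pM2l ?mulr_gt0//.
by apply: le_trans (ltW lt); apply: ka_mono; rewrite ?u00 ?T00.
Qed.

(** The target [rho (N k)] must recede faster than the base point [c (b k)]: since [B k] and [N k]
    differ by at most [b k], their ratio then tends to 1. *)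
Let N (k : nat) : R := b k ^+ 2.
Let B (k : nat) : R := mdist (c (b k)) (rho (N k)).
Let pt (u : R) (k : nat) : X := geo (c (b k)) (rho (N k)) (u / B k).
Let r (u : R) : X := ulim (fun k => phi k (pt u k)).

Let near_b (M : R) : \forall k \near ufilter, M <= b k.
Proof.
near=> k; apply: le_trans (bk k); near: k.
by apply: near_ufilter; exact: nbhs_infty_ger.
Unshelve. all: by end_near. Qed.

Let BN (k : nat) : 0 <= b k -> `|B k - N k| <= b k.
Proof.
move=> b0; have N0 : 0 <= N k by exact: sqr_ge0.
have h0 : mdist (c 0) (c (b k)) = b k by rewrite hc sub0r normrN ger0_norm.
have h1 : mdist (c 0) (rho (N k)) = N k.
  by rewrite -rho0 rhod// sub0r normrN ger0_norm.
have := metric_triangle (c 0) (c (b k)) (rho (N k)).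
have := metric_triangle (c (b k)) (c 0) (rho (N k)).
rewrite (metric_sym _ (c 0)) h0 h1 -/(B k) => t1 t2.
by rewrite ler_norml; apply/andP; split; lra.
Qed.

Let near_B (M : R) : \forall k \near ufilter, M <= B k.
Proof.
near=> k.
have b2 : 2 <= b k by near: k; exact: near_b.
have bM : M <= b k by near: k; exact: near_b.
have b0 : 0 <= b k by lra.
have := BN b0; rewrite ler_norml /N => /andP[h _].
by move: h; rewrite expr2; nra.
Unshelve. all: by end_near. Qed.

Let ib_cvg : (b k)^-1 @[k --> ufilter] --> (0 : R).
Proof.
apply/cvgrPdist_le => e e0; near=> k.
have h : e^-1 <= b k by near: k; exact: near_b.
have b0 : 0 < b k by apply: lt_le_trans h; rewrite invr_gt0.
by rewrite sub0r normrN gtr0_norm ?invr_gt0// invf_ple ?posrE.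
Unshelve. all: by end_near. Qed.

Let w_cvg : (B k / N k) @[k --> ufilter] --> (1 : R).
Proof.
apply/cvgrPdist_le => e e0; near=> k.
have h : e^-1 <= b k by near: k; exact: near_b.
have b0 : 0 < b k by apply: lt_le_trans h; rewrite invr_gt0.
have N0 : 0 < N k by rewrite exprn_gt0.
have -> : 1 - B k / N k = (N k - B k) / N k by field; rewrite gt_eqF.
rewrite normrM normfV (gtr0_norm N0) ler_pdivrMr// distrC.
apply: le_trans (BN (ltW b0)) _.
rewrite /N expr2 mulrA ler_peMl ?(ltW b0)//.
by rewrite -ler_pdivrMl// mulr1.
Unshelve. all: by end_near. Qed.

Let pt_bounded (u : R) : 0 <= u -> ubounded (fun k => phi k (pt u k)).
Proof.
move=> u0; exists (c 0), u; near=> k.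
have Bu : u + 1 <= B k by near: k; exact: near_B.
have B0 : 0 < B k by lra.
have -> : c 0 = phi k (c (b k)) by rewrite phic subrr.
rewrite phid /pt geo_mdistl// ?divfK ?gt_eqF//.
by rewrite divr_ge0 ?(ltW B0)//= ler_pdivrMr// mul1r; lra.
Unshelve. all: by end_near. Qed.

Let r0 : r 0 = c 0.
Proof.
rewrite -(ulim_cst pX (c 0)) /r; congr ulim; apply/funext => k.
by rewrite /pt mul0r geo0// phic subrr.
Qed.

Let rd (u v : R) : 0 <= u -> 0 <= v -> mdist (r u) (r v) = `|u - v|.
Proof.
move=> u0 v0; apply: (ulim_mdist_eq pX (pt_bounded u0) (pt_bounded v0)
  (a := fun=> `|u - v|)); first exact: cvg_cst.
near=> k.
have Bu : u + v + 1 <= B k by near: k; exact: near_B.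
have B0 : 0 < B k by lra.
rewrite phid /pt geo_mdist// ?divr_ge0 ?(ltW B0)//= ?ler_pdivrMr// ?mul1r;
  [|lra|lra].
rewrite -mulrBl normrM normfV (gtr0_norm B0) divfK// gt_eqF//.
Unshelve. all: by end_near. Qed.

Let r_pos (u T : R) : 0 <= u -> 0 <= T ->
  mdist (r u) (c T) ^+ 2 <= u ^+ 2 + T ^+ 2 - 2 * u * T * C.
Proof.
move=> u0 T0; rewrite -(ulim_cst pX (c T)).
(* Twice a lower bound for the comparison cosine at [c (b k)] between [rho (N k)] and
   [c (b k + N k)], with [b k / N k] written [(b k)^-1]; it tends to [2 * C]. *)
pose g (k : nat) : R := ((B k / N k) ^+ 2 - (1 + (b k)^-1) ^+ 2 +
  2 * (1 + (b k)^-1) * C) / (B k / N k).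
apply: (ulim_sqr_mdist_le pX (pt_bounded u0) (ubounded_cst (c T))
  (a := fun k => u ^+ 2 + T ^+ 2 - u * T * g k)).
  have -> : 2 * u * T * C = u * T *
      ((1 ^+ 2 - (1 + 0) ^+ 2 + 2 * (1 + 0) * C) / 1) by field.
  apply: cvgB; first exact: cvg_cst.
  apply: cvgM; first exact: cvg_cst.
  have cv1 : (1 + (b k)^-1) @[k --> ufilter] --> (1 + 0 : R).
    by apply: cvgD; [exact: cvg_cst|exact: ib_cvg].
  apply: cvgM; last by apply: cvgV w_cvg; exact: oner_neq0.
  apply: cvgD; last first.
    by apply: cvgM; [apply: cvgM => //; exact: cvg_cst|exact: cvg_cst].
  by apply: cvgB; rewrite expr2; apply: cvgM.
near=> k.
have b1 : 1 <= b k by near: k; exact: near_b.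
have bT : T <= b k by near: k; exact: near_b.
have Bu : u + 1 <= B k by near: k; exact: near_B.
have B0 : 0 < B k by lra.
have b0 : 0 < b k by lra.
have N0 : 0 < N k by rewrite exprn_gt0.
have NT : T <= N k by rewrite (le_trans bT)// /N expr2 ler_peMl// ltW.
have -> : c T = phi k (c (b k + T)) by rewrite phic addrAC subrr add0r.
rewrite phid.
have := @ray_geo _ _ HX (fun t => c (b k + t)) (N k) T.
rewrite addr0 => ->; last 3 first.
- by move=> x y _ _; rewrite hc; congr `|_|; ring.
- by rewrite T0.
- exact: N0.
apply: le_trans (cat0_comparison HX _ _ _ _ _) _.
- by rewrite divr_ge0 ?(ltW B0)//= ler_pdivrMr// mul1r; lra.
- by rewrite divr_ge0 ?(ltW N0)//= ler_pdivrMr// mul1r.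
rewrite -/(B k) hc opprD addrA subrr sub0r normrN (gtr0_norm N0).
have bN0 : 0 <= b k + N k by lra.
have := le_C (ltW N0) bN0 => hD.
have -> : u ^+ 2 + T ^+ 2 - u * T * g k = (u / B k) ^+ 2 * B k ^+ 2 +
  (T / N k) ^+ 2 * N k ^+ 2 - u / B k * (T / N k) * (B k ^+ 2 + N k ^+ 2 -
  (N k ^+ 2 + (b k + N k) ^+ 2 - 2 * N k * (b k + N k) * C)).
  by rewrite /g /N; field; rewrite !gt_eqF.
rewrite lerD2l lerN2 ler_wpM2l ?mulr_ge0 ?invr_ge0 ?(ltW B0) ?(ltW N0)//.
by rewrite lerD2l lerN2.
Unshelve. all: by end_near. Qed.

Let r_neg (u S : R) : 0 <= u -> 0 <= S ->
  mdist (r u) (c (- S)) ^+ 2 <= u ^+ 2 + S ^+ 2 + 2 * u * S * C.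
Proof.
move=> u0 S0; apply/ler_addgt0Pr => e e0.
have den0 : 0 < 2 * u * S + 1 by rewrite ltr_wpDl// !mulr_ge0.
pose e' := e / (2 * u * S + 1).
have e'0 : 0 < e' by rewrite divr_gt0.
apply: (@le_trans _ _ (u ^+ 2 + S ^+ 2 + 2 * u * S * (C + e'))); last first.
  have <- : e' * (2 * u * S + 1) = e by rewrite divfK// gt_eqF.
  lra.
have [M hM] := C_lim e'0.
rewrite -(ulim_cst pX (c (- S))).
(* The same in the triangle with vertices [c (b k)], [rho (N k)] and [c 0], where [C_lim] bounds
   [B k] from below; the limit is [- 2 * (C + e')]. *)
pose g (k : nat) : R := (2 * (b k)^-1 - 2 * (C + e')) / (B k / N k).
apply: (ulim_sqr_mdist_le pX (pt_bounded u0) (ubounded_cst (c (- S)))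
  (a := fun k => u ^+ 2 + S ^+ 2 - u * S * g k)).
  have -> : u ^+ 2 + S ^+ 2 + 2 * u * S * (C + e') = u ^+ 2 + S ^+ 2 -
    u * S * ((2 * 0 - 2 * (C + e')) / 1) by field.
  apply: cvgB; first exact: cvg_cst.
  apply: cvgM; first exact: cvg_cst.
  apply: cvgM; last by apply: cvgV w_cvg; exact: oner_neq0.
  apply: cvgB; last exact: cvg_cst.
  by apply: cvgM ib_cvg; exact: cvg_cst.
near=> k.
have b1 : 1 <= b k by near: k; exact: near_b.
have bS : S <= b k by near: k; exact: near_b.
have bM : M <= b k by near: k; exact: near_b.
have Bu : u + 1 <= B k by near: k; exact: near_B.
have B0 : 0 < B k by lra.
have b0 : 0 < b k by lra.
have N0 : 0 < N k by rewrite exprn_gt0.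
have NM : M <= N k by rewrite (le_trans bM)// /N expr2 ler_peMl// ltW.
have -> : c (- S) = phi k (c (b k - S)) by rewrite phic addrAC subrr add0r.
rewrite phid.
have := @ray_geo _ _ HX (fun t => c (b k - t)) (b k) S.
rewrite subr0 subrr => ->; last 3 first.
- by move=> x y _ _; rewrite hc distrC; congr `|_|; ring.
- by rewrite S0.
- exact: b0.
apply: le_trans (cat0_comparison HX _ _ _ _ _) _.
- by rewrite divr_ge0 ?(ltW B0)//= ler_pdivrMr// mul1r; lra.
- by rewrite divr_ge0 ?(ltW b0)//= ler_pdivrMr// mul1r.
rewrite -/(B k) hc subr0 (gtr0_norm b0) -rho0 rhod ?(ltW N0)// subr0.
rewrite (gtr0_norm N0).
have := hM _ _ N0 b0 NM bM; rewrite metric_sym -/(B k) => hB.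
have -> : u ^+ 2 + S ^+ 2 - u * S * g k = (u / B k) ^+ 2 * B k ^+ 2 +
  (S / b k) ^+ 2 * b k ^+ 2 - u / B k * (S / b k) *
  (2 * b k ^+ 2 - 2 * N k * b k * (C + e')).
  by rewrite /g /N; field; rewrite !gt_eqF.
rewrite lerD2l lerN2 ler_wpM2l ?mulr_ge0 ?invr_ge0 ?(ltW B0) ?(ltW b0)//.
lra.
Unshelve. all: by end_near. Qed.

(** The bounds towards the two ends of [c] correspond to supplementary angles, and [c 0] is the
    midpoint of [c T] and [c (- T)]: Stewart's inequality leaves no slack. *)
Let rcE (u T : R) : 0 <= u ->
  mdist (r u) (c T) ^+ 2 = (T - u * C) ^+ 2 + u ^+ 2 * (1 - C ^+ 2).
Proof.
move=> u0; have le (S : R) : mdist (r u) (c S) ^+ 2 <=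
    u ^+ 2 + S ^+ 2 - 2 * u * S * C.
  have [S0|S0] := leP 0 S; first exact: r_pos.
  have nS0 : 0 <= - S by lra.
  by have := r_neg u0 nS0; rewrite opprK sqrrN; lra.
have h2 : 0 <= (2^-1 : R) <= 1 by lra.
have := cat0_stewart HX (r u) (c T) (c (- T)) h2.
rewrite -geodesic_line_geo//.
have -> : (1 - 2^-1) * T + 2^-1 * - T = 0 by field.
rewrite -r0 rd// hc !real_normK ?num_real// => ge.
apply/eqP; rewrite eq_le; apply/andP; split; first by have := le T; lra.
have := le (- T); rewrite sqrrN; lra.
Qed.

Lemma flat_half_plane_of_angle : bounds_flat_half_plane c.
Proof. exact: (flat_half_plane_of_ray HX pX hc C_lt1 r0 rd rcE). Qed.

End Renormalization.

(** * Contraction along a rank-1 axis *)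

(* In triangles [o p y] and [o y q] glued along [o y] with [y] on [p q], the
   angles at [o] sum to at most [pi]; here [cos (o; p, y) <= 7/8] yields
   [cos (o; y, q) >= -15/16]. *)
Lemma glued_angle_bound {R : realType} (a b e m l : R) :
  0 < a -> 0 < b -> 0 < e -> 0 <= l -> 0 <= m ->
  m + l <= a + e -> l <= b + e -> a ^+ 2 + b ^+ 2 - m ^+ 2 <= 7 / 4 * a * b ->
  l ^+ 2 <= b ^+ 2 + e ^+ 2 + 15 / 8 * b * e.
Proof.
move=> a0 b0 e0 l0 m0 ml lbe hm; rewrite leNgt; apply/negP => lt.
(* The saving of [l] over the path through [o]. If the claim fails then [x < b / 8], whereas the
   hypothesis on [m] forces [a * b / 4 <= 2 * a * x]. *)
pose x := b + e - l.
have x0 : 0 <= x by rewrite /x; lra.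
have be : 0 < b + e by lra.
have xb : x < b / 8.
  have h : x * (b + e) < b / 8 * (b + e).
    have h1 : x * (b + e) <= x * (b + e + l) by rewrite ler_wpM2l//; lra.
    have h2 : x * (b + e + l) < b * e / 8 by rewrite /x; lra.
    have h3 : 0 <= b * b / 8 by rewrite divr_ge0 ?mulr_ge0 ?ltW.
    by lra.
  by rewrite ltr_pM2r in h.
have mx : m <= a - b + x by rewrite /x; lra.
have m2 : m ^+ 2 <= (a - b + x) ^+ 2 by rewrite ler_sqr ?nnegrE//; lra.
have h1 : a * b / 4 <= x * (2 * a - 2 * b + x) by lra.
have h2 : x * (2 * a - 2 * b + x) <= x * (2 * a) by rewrite ler_wpM2l//; lra.
have h3 : x * (2 * a) < b / 8 * (2 * a) by rewrite ltr_pM2r//; lra.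
lra.
Qed.

Section Visual.
Context {R : realType} {X : metricType R}.
Hypothesis HX : cat0_space X.
Implicit Types o p q x y : X.

(** The direction of [p] seen from [o], as a point of the unit sphere; meaningful only when
    [1 <= mdist o p]. *)
Definition visual o p : X := geo o p (mdist o p)^-1.

Let inv01 o p : 1 <= mdist o p -> 0 <= (mdist o p)^-1 <= 1.
Proof. by move=> h; rewrite invr_ge0 mdist_ge0 invf_le1// (lt_le_trans _ h). Qed.

Lemma visual_lip o x y : 1 <= mdist o x -> 1 <= mdist o y ->
  mdist (visual o x) (visual o y) <= 2 * mdist x y.
Proof.
move=> x1 y1; have x0 : 0 < mdist o x by exact: lt_le_trans x1.
have y0 : 0 < mdist o y by exact: lt_le_trans y1.
have /andP[ix0 ix1] := inv01 x1.
apply: le_trans (metric_triangle _ (geo o y (mdist o x)^-1) _) _.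
have h1 := geo_ratio HX o x y (inv01 x1).
have h2 : (mdist o x)^-1 * mdist x y <= mdist x y.
  by rewrite ler_piMl ?mdist_ge0.
have h3 : mdist (geo o y (mdist o x)^-1) (visual o y) <= mdist x y.
  rewrite /visual geo_mdist ?inv01//.
  rewrite -[X in _ * X](gtr0_norm y0) -normrM mulrBl mulVf ?gt_eqF//.
  have -> : (mdist o x)^-1 * mdist o y - 1 =
      (mdist o x)^-1 * (mdist o y - mdist o x) by field; rewrite gt_eqF.
  rewrite normrM (ger0_norm ix0).
  have : `|mdist o y - mdist o x| <= mdist x y.
    have := metric_triangle o x y; have := metric_triangle o y x.
    by rewrite (metric_sym y x) => *; rewrite ler_norml; apply/andP; split; lra.
  have : (mdist o x)^-1 * `|mdist o y - mdist o x| <= `|mdist o y - mdist o x|.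
    by rewrite ler_piMl.
  lra.
rewrite /visual in h1 h3 *; lra.
Qed.

Lemma visual_crossing o p q m :
  (forall f : R, 0 <= f <= 1 -> 1 <= mdist o (geo p q f)) ->
  1 <= mdist (visual o p) m -> visual o q = m ->
  exists2 f : R, 0 <= f <= 1 & mdist (visual o (geo p q f)) m = 2^-1.
Proof.
move=> far vp vq.
(* Clamping the parameter makes [F] below Lipschitz on the whole line, ready for the intermediate
   value theorem. *)
pose cl (t : R) : R := Num.max 0 (Num.min 1 t).
have clE t : [\/ t <= 0 /\ cl t = 0, 0 <= t <= 1 /\ cl t = t | 1 <= t /\ cl t = 1].
  rewrite /cl; have [t1|t1] := leP 1 t.
    by apply: Or33; rewrite max_r.
  have [t0|t0] := leP 0 t; last by apply: Or31; split=> //; exact: ltW.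
  by apply: Or32; split=> //; exact: ltW.
have cl01 t : 0 <= cl t <= 1.
  by case: (clE t) => -[h ->] //; rewrite ?lexx ?ler01.
have cl_lip s t : `|cl s - cl t| <= `|s - t|.
  rewrite ler_norml; have := ler_norm (s - t); have := ler_norm (- (s - t)).
  rewrite normrN => h1 h2; apply/andP.
  by case: (clE s) => -[hs ->]; case: (clE t) => -[ht ->]; split; lra.
pose F t : R := mdist (visual o (geo p q (cl t))) m.
have F_lip s t : `|F s - F t| <= 2 * mdist p q * `|s - t|.
  have h : mdist (visual o (geo p q (cl s))) (visual o (geo p q (cl t))) <=
      2 * mdist p q * `|s - t|.
    apply: le_trans (visual_lip (far _ (cl01 s)) (far _ (cl01 t))) _.
    rewrite geo_mdist// -mulrA ler_pM2l// mulrC.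
    by rewrite ler_wpM2l ?mdist_ge0.
  rewrite /F ler_norml; apply/andP; split.
    have := metric_triangle (visual o (geo p q (cl t)))
      (visual o (geo p q (cl s))) m.
    rewrite (metric_sym (visual o (geo p q (cl t))) (visual _ _)); lra.
  have := metric_triangle (visual o (geo p q (cl s)))
    (visual o (geo p q (cl t))) m.
  lra.
have F_cont : continuous F.
  move=> s; apply/cvgrPdist_le => e e0.
  have d0 := mdist_ge0 p q; have den : 0 < 2 * mdist p q + 1 by lra.
  near=> t; apply: le_trans (F_lip s t) _.
  have : `|s - t| <= e / (2 * mdist p q + 1).
    near: t; apply: cvgr_dist_le; first exact: cvg_id.
    by rewrite divr_gt0.
  rewrite ler_pdivlMr// => h; have := normr_ge0 (s - t); lra.
have cl0 : cl 0 = 0 by case: (clE 0) => -[h ->] //; lra.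
have cl1 : cl 1 = 1 by case: (clE 1) => -[h ->] //; lra.
have F0 : 1 <= F 0 by rewrite /F cl0 geo0.
have F1 : F 1 = 0 by rewrite /F cl1 geo1// vq mdistxx.
have [||t] := @IVT R F 0 1 2^-1 ler01.
- exact: continuous_subspaceT.
- by rewrite F1 min_r ?max_l//; lra.
by exists (cl t).
Unshelve. all: by end_near. Qed.

End Visual.

Section Rank1.
Context {R : realType} {X : metricType R}.
Hypotheses (HX : cat0_space X) (pX : proper_space X).
Variables (c : R -> X) (phi : nat -> X -> X) (b : nat -> R).
Hypothesis hc : geodesic_line c.
Hypothesis bk : forall k, k%:R <= b k.
Hypothesis phid : forall k x y, mdist (phi k x) (phi k y) = mdist x y.
Hypothesis phic : forall k t, phi k (c t) = c (t - b k).
Hypothesis nflat : ~ bounds_flat_half_plane c.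

(** The direction moves continuously from that of [p] to [c 1], so some [y] on the way has direction
    at distance [1/2] from [c 1], hence at least [1/2] from that of [p]. The comparison cosine of
    [p] and [y] is then at most [1 - (1/2)^2 / 2 = 7/8], as [glued_angle_bound] requires. *)
Let far_point (D t : R) (p : X) : 1 <= D -> 0 <= t ->
  1 <= mdist (visual (c 0) p) (c 1) ->
  (forall f : R, 0 <= f <= 1 -> D < mdist (c 0) (geo p (c t) f)) ->
  exists y, [/\ D < mdist (c 0) y, mdist (visual (c 0) y) (c 1) = 2^-1, D < t &
    mdist y (c t) ^+ 2 <=
      mdist (c 0) y ^+ 2 + t ^+ 2 + 15 / 8 * mdist (c 0) y * t].
Proof.
move=> D1 t0 vp far.
have i0 : 0 <= (0 : R) <= 1 by rewrite lexx ler01.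
have i1 : 0 <= (1 : R) <= 1 by rewrite lexx ler01.
have Dp := far _ i0; rewrite geo0// in Dp.
have Dt := far _ i1; rewrite geo1// hc sub0r normrN ger0_norm// in Dt.
have ct : mdist (c 0) (c t) = t by rewrite hc sub0r normrN ger0_norm.
have vq : visual (c 0) (c t) = c 1.
  have t0' : 0 < t by lra.
  rewrite /visual ct -[t^-1]mul1r; apply/esym/(ray_geo HX) => //.
  by rewrite ler01; lra.
have [|f f01 vf] := visual_crossing HX _ vp vq.
  by move=> f /far; lra.
exists (geo p (c t) f); have Df := far _ f01; split => //.
set y := geo p (c t) f in vf Df *.
have py := geo_mdistl HX p (c t) f01; have yq := geo_mdistr HX p (c t) f01.
rewrite -/y in py yq.
apply: (@glued_angle_bound _ (mdist (c 0) p) _ _ (mdist p y));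
  rewrite ?mdist_ge0//; try lra.
- rewrite py yq -mulrDl addrC subrK mul1r -[X in _ + X]ct (metric_sym (c 0) p).
  exact: metric_triangle.
- by rewrite -[X in _ + X]ct (metric_sym (c 0) y); exact: metric_triangle.
have p0 : 0 < mdist (c 0) p by lra.
have y0 : 0 < mdist (c 0) y by lra.
have pi : 0 <= (mdist (c 0) p)^-1 <= 1.
  by rewrite invr_ge0 (ltW p0) invf_le1//; lra.
have yi : 0 <= (mdist (c 0) y)^-1 <= 1.
  by rewrite invr_ge0 (ltW y0) invf_le1//; lra.
have := cat0_comparison HX (c 0) p y pi yi.
have half : 2^-1 <= mdist (visual (c 0) p) (visual (c 0) y).
  have := metric_triangle (visual (c 0) p) (visual (c 0) y) (c 1).
  by rewrite vf; lra.
have : 2^-1 ^+ 2 <= mdist (visual (c 0) p) (visual (c 0) y) ^+ 2.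
  by rewrite ler_sqr ?nnegrE ?mdist_ge0//; lra.
move=> /le_trans /[apply].
rewrite -!exprMn !mulVf ?gt_eqF// expr1n -invfM => h.
have : (mdist (c 0) p * mdist (c 0) y)^-1 *
  (mdist (c 0) p ^+ 2 + mdist (c 0) y ^+ 2 - mdist p y ^+ 2) <= 7 / 4 by lra.
by rewrite ler_pdivrMl ?mulr_gt0//; lra.
Qed.

Lemma rank1_half_contracting : exists D : R, forall (p : X) (t : R), 0 <= t ->
  1 <= mdist (visual (c 0) p) (c 1) ->
  exists2 f : R, 0 <= f <= 1 & mdist (c 0) (geo p (c t) f) <= D.
Proof.
apply: contrapT => /forallNP H; apply: nflat.
have step (n : nat) : exists yt : X * R,
    [/\ 1 + n%:R < mdist (c 0) yt.1, mdist (visual (c 0) yt.1) (c 1) = 2^-1,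
        1 + n%:R < yt.2 & mdist yt.1 (c yt.2) ^+ 2 <= mdist (c 0) yt.1 ^+ 2 +
          yt.2 ^+ 2 + 15 / 8 * mdist (c 0) yt.1 * yt.2].
  (* Radii [1 + n%:R] are at least 1, so directions are meaningful outside these balls. *)
  have /existsNP[p /existsNP[t]] := H (1 + n%:R).
  move=> /not_implyP[t0 /not_implyP[vp hf]].
  have n1 : 1 <= 1 + n%:R :> R by rewrite lerDl.
  have [|y hy] := far_point n1 t0 vp; last by exists (y, t).
  move=> f f01; rewrite ltNge; apply/negP => le.
  by apply: hf; exists f.
have [yt hyt] := choice step.
pose y n := (yt n).1; pose t n := (yt n).2.
have hy n : [/\ 1 + n%:R < mdist (c 0) (y n),
  mdist (visual (c 0) (y n)) (c 1) = 2^-1, 1 + n%:R < t n &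
  mdist (y n) (c (t n)) ^+ 2 <= mdist (c 0) (y n) ^+ 2 + t n ^+ 2 +
    15 / 8 * mdist (c 0) (y n) * t n] by exact: hyt.
pose pt u n : X := geo (c 0) (y n) (u / mdist (c 0) (y n)).
(* A limit of the segments from [c 0] to [y n]; the distance [1/2] at time 1 and the cosine bound
   [-15/16] pass to the limit. *)
pose rho u : X := ulim (pt u).
have frac (u : R) n : 0 <= u -> u <= n%:R -> 0 <= u / mdist (c 0) (y n) <= 1.
  move=> u0 un; have [h _ _ _] := hy n.
  have n0 : 0 <= n%:R :> R by [].
  by rewrite divr_ge0 ?mdist_ge0//= ler_pdivrMr ?mul1r; lra.
have y0 n : 0 < mdist (c 0) (y n).
  have [h _ _ _] := hy n; apply: le_lt_trans h.
  by rewrite addr_ge0.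
have pt_bounded (u : R) : 0 <= u -> ubounded (pt u).
  move=> u0; exists (c 0), u; near=> n.
  have un : u <= n%:R by near: n; apply: near_ufilter; exact: nbhs_infty_ger.
  by rewrite geo_mdistl ?frac// divfK// gt_eqF.
apply: (@flat_half_plane_of_angle _ _ HX pX c rho phi b) => //.
- rewrite -(ulim_cst pX (c 0)) /rho; congr ulim; apply/funext => n.
  by rewrite /pt mul0r geo0.
- move=> u v u0 v0; apply: (ulim_mdist_eq pX (pt_bounded _ u0)
    (pt_bounded _ v0) (a := fun=> `|u - v|)); first exact: cvg_cst.
  near=> n.
  have un : u <= n%:R by near: n; apply: near_ufilter; exact: nbhs_infty_ger.
  have vn : v <= n%:R by near: n; apply: near_ufilter; exact: nbhs_infty_ger.
  rewrite geo_mdist ?frac// -mulrBl normrM normfV (gtr0_norm (y0 n)).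
  by rewrite divfK// gt_eqF.
- move=> u T u0 T0; rewrite -(ulim_cst pX (c T)).
  apply: (ulim_sqr_mdist_le pX (pt_bounded _ u0) (ubounded_cst (c T))
    (a := fun=> u ^+ 2 + T ^+ 2 + 15 / 8 * u * T)); first exact: cvg_cst.
  near=> n.
  have un : u <= n%:R by near: n; apply: near_ufilter; exact: nbhs_infty_ger.
  have Tn : T <= n%:R by near: n; apply: near_ufilter; exact: nbhs_infty_ger.
  have [h1 _ h2 h3] := hy n; have yn := y0 n.
  have n0 : 0 <= n%:R :> R by [].
  have t0 : 0 < t n by lra.
  have ct : mdist (c 0) (c (t n)) = t n by rewrite hc sub0r normrN gtr0_norm.
  have -> : c T = geo (c 0) (c (t n)) (T / t n).
    by apply: ray_geo => //; rewrite T0; lra.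
  apply: le_trans (cat0_comparison HX _ _ _ (frac _ _ u0 un) _) _.
    by rewrite divr_ge0 ?(ltW t0)//= ler_pdivrMr// mul1r; lra.
  rewrite ct.
  have -> : u ^+ 2 + T ^+ 2 + 15 / 8 * u * T =
    (u / mdist (c 0) (y n)) ^+ 2 * mdist (c 0) (y n) ^+ 2 +
    (T / t n) ^+ 2 * t n ^+ 2 - u / mdist (c 0) (y n) * (T / t n) *
    - (15 / 8 * mdist (c 0) (y n) * t n) by field; rewrite !gt_eqF.
  rewrite lerD2l lerN2 ler_wpM2l ?mulr_ge0 ?invr_ge0 ?(ltW t0) ?(ltW yn)//.
  lra.
- rewrite -(ulim_cst pX (c 1)).
  apply: (ulim_mdist_eq pX (pt_bounded _ ler01) (ubounded_cst (c 1))
    (a := fun=> 2^-1)); first exact: cvg_cst.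
  near=> n; have [_ h _ _] := hy n.
  by rewrite -h /pt /visual mul1r.
Unshelve. all: by end_near. Qed.

End Rank1.

(** Taking powers of [f ^ m] with [1 <= m * be] makes the [k]-th shift at least [k]. *)
Lemma shift_iter {R : realType} {X : metricType R} (c : R -> X) (f : X -> X)
    (be : R) : 0 < be -> (forall x y, mdist (f x) (f y) = mdist x y) ->
  (forall t, f (c t) = c (t - be)) ->
  exists (phi : nat -> X -> X) (b : nat -> R), [/\ forall k, k%:R <= b k,
    forall k x y, mdist (phi k x) (phi k y) = mdist x y &
    forall k t, phi k (c t) = c (t - b k)].
Proof.
move=> be0 fd fc; pose m := (Num.truncn be^-1).+1.
have mbe : 1 <= m%:R * be.
  by rewrite -ler_pdivrMr// mul1r ltW// truncnS_gt// invr_ge0 ltW.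
exists (fun k => iter (k * m) f), (fun k => (k * m)%:R * be); split.
- by move=> k; rewrite natrM -mulrA ler_peMr.
- by move=> k x y; elim: (k * m)%N => //= n IH; rewrite fd.
- move=> k; elim: (k * m)%N => [|n IH] t /=; first by rewrite mul0r subr0.
  by rewrite IH fc; congr c; rewrite -natr1; ring.
Qed.

(** The directions [c 1] and [c (- 1)] are at distance 2, so that of [p] is at distance at least 1
    from one of them; the half-line version applies to [c] or to its reversal, which [f'] shifts as
    [f] shifts [c]. *)
Lemma rank1_contracting {R : realType} {X : metricType R} (c : R -> X)
    (f f' : X -> X) (be : R) :
  cat0_space X -> proper_space X -> geodesic_line c ->
  ~ bounds_flat_half_plane c -> 0 < be ->
  (forall x y, mdist (f x) (f y) = mdist x y) ->
  (forall x y, mdist (f' x) (f' y) = mdist x y) ->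
  (forall t, f (c t) = c (t - be)) -> (forall t, f' (c t) = c (t + be)) ->
  exists D : R, forall (p : X) (t : R), 0 <= t ->
    exists2 u : R, 0 <= u <= 1 &
      mdist (c 0) (geo p (c t) u) <= D \/ mdist (c 0) (geo p (c (- t)) u) <= D.
Proof.
move=> HX pX hc nflat be0 fd f'd fc f'c.
pose c' (t : R) : X := c (- t).
have hc' : geodesic_line c'.
  by move=> s t; rewrite hc -opprD normrN.
have nflat' : ~ bounds_flat_half_plane c'.
  move=> [h [hd himg]]; apply: nflat; exists h; split => //.
  rewrite himg; apply/seteqP; split => x [t _ <-]; exists (- t) => //.
  by rewrite /c' opprK.
have f'c' t : f' (c' t) = c' (t - be) by rewrite /c' f'c opprB addrC.
have [phi [b [bk phid phic]]] := shift_iter be0 fd fc.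
have [phi' [b' [b'k phi'd phi'c]]] := shift_iter be0 f'd f'c'.
have [D hD] := rank1_half_contracting HX pX hc bk phid phic nflat.
have [D' hD'] := rank1_half_contracting HX pX hc' b'k phi'd phi'c nflat'.
exists (Num.max D D') => p t t0.
have [v1|v1] := leP 1 (mdist (visual (c 0) p) (c 1)).
  have [u u01 le] := hD p t t0 v1; exists u => //.
  by left; rewrite le_max le.
have v1' : 1 <= mdist (visual (c' 0) p) (c' 1).
  have := metric_triangle (c 1) (visual (c 0) p) (c (- 1)).
  rewrite hc opprK (metric_sym (c 1)) /c' oppr0 ger0_norm//; lra.
have [u u01 le] := hD' p t t0 v1'; exists u => //.
by right; move: le; rewrite /c' oppr0 le_max orbC => ->.
Qed.

(** * Translation lengths *)

Section TranslationLength.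
Context {R : realType} {G : groupType} {X : metricType R}.
Hypothesis HX : cat0_space X.
Variable a : isometric_action G X.

Lemma act_mdist g x y : mdist (a g x) (a g y) = mdist x y.
Proof. exact: (act_isometry a g).2. Qed.

Lemma act_invr g x : a g^-1%g (a g x) = x.
Proof. by rewrite -act_mul mulVg act_one. Qed.

Lemma act_inv_mdist g x : mdist x (a g^-1%g x) = mdist x (a g x).
Proof. by rewrite -(act_mdist g) -act_mul mulgV act_one metric_sym. Qed.

Let tl_lb g : has_lbound (range (fun x : X => mdist x (a g x))).
Proof. by exists 0 => _ [x _ <-]; exact: mdist_ge0. Qed.

Lemma translation_length_le g x : translation_length a g <= mdist x (a g x).
Proof. by apply: ge_inf => //; exists x. Qed.

(* [g] moves the midpoint of [x, g x] by at most half of [d (x, g^2 x)]. *)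
Lemma translation_length_sqr (o : X) g :
  2 * translation_length a g <= translation_length a (g * g)%g.
Proof.
apply: lb_le_inf; first by exists (mdist o (a (g * g)%g o)), o.
move=> _ [x _ <-].
have h2 : 0 <= (2^-1 : R) <= 1 by lra.
pose m := geo (a g x) x 2^-1.
have am : a g m = geo (a g x) (a (g * g)%g x) 2^-1.
  have d1 := geo_mdistl HX (a g x) x h2; have d2 := geo_mdistr HX (a g x) x h2.
  apply: (geo_uniq HX h2); rewrite act_mul !act_mdist (metric_sym x (a g x)).
    by rewrite (metric_sym x) d2; field.
  by rewrite (metric_sym m) d1; field.
have := translation_length_le g m.
have := geo_ratio HX (a g x) x (a (g * g)%g x) h2.
rewrite -am -/m; lra.
Qed.

Lemma translation_length_pow2 (o : X) g k :
  2 ^+ k * translation_length a g <= translation_length a (g ^+ (2 ^ k)%N)%g.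
Proof.
elim: k => [|k IH]; first by rewrite mul1r expn0 expg1.
rewrite expnSr expgnA exprS -mulrA; set g' := (g ^+ (2 ^ k))%g in IH *.
have := translation_length_sqr o g'; rewrite -expg2.
by move: IH; lra.
Qed.

Lemma mdist_act_pow_le g n (o x : X) :
  mdist o (a (g ^+ n)%g o) <= n%:R * mdist x (a g x) + 2 * mdist o x.
Proof.
have h : mdist x (a (g ^+ n)%g x) <= n%:R * mdist x (a g x).
  elim: n => [|n IH]; first by rewrite expg0 act_one mdistxx mul0r.
  rewrite expgS act_mul -natr1.
  have := metric_triangle x (a g x) (a g (a (g ^+ n)%g x)).
  rewrite act_mdist; lra.
have := metric_triangle o x (a (g ^+ n)%g o).
have := metric_triangle x (a (g ^+ n)%g x) (a (g ^+ n)%g o).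
rewrite act_mdist (metric_sym x o); lra.
Qed.

(** Powers of two suffice: iterating the doubling inequality bounds the quotient from below, and a
    point of nearly minimal displacement bounds it from above. *)
Lemma translation_length_cvg g (o : X) :
  mdist o (a (g ^+ (2 ^ k)%N)%g o) / 2 ^+ k @[k --> \oo] -->
  translation_length a g.
Proof.
apply/cvgrPdist_le => e e0; have e2 : 0 < e / 2 by lra.
have ne : has_inf (range (fun x : X => mdist x (a g x))).
  by split=> //; exists (mdist o (a g o)), o.
have [_ [x _ <-] hx] := inf_adherent e2 ne.
rewrite -/(translation_length a g) in hx.
near=> k.
have hk : 2 * mdist o x / (e / 2) <= k%:R.
  by near: k; exact: nbhs_infty_ger.
have k2 : (k%:R : R) <= 2 ^+ k by rewrite -natrX ler_nat ltnW// ltn_expl.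
have p2 : 0 < (2 : R) ^+ k by rewrite exprn_gt0.
have le1 : translation_length a g <= mdist o (a (g ^+ (2 ^ k)%N)%g o) / 2 ^+ k.
  rewrite ler_pdivlMr// mulrC (le_trans (translation_length_pow2 o g k))//.
  exact: translation_length_le.
have le2 : mdist o (a (g ^+ (2 ^ k)%N)%g o) / 2 ^+ k <=
    translation_length a g + e.
  rewrite ler_pdivrMr// (le_trans (mdist_act_pow_le g (2 ^ k) o x))//.
  have h1 : 2 * mdist o x <= 2 ^+ k * (e / 2).
    by rewrite -ler_pdivrMr// (le_trans hk).
  have h2 : 2 ^+ k * mdist x (a g x) <=
      2 ^+ k * (translation_length a g + e / 2) by rewrite ler_pM2l// ltW.
  rewrite natrX; lra.
rewrite ler_norml; apply/andP; split; lra.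
Unshelve. all: by end_near. Qed.

Lemma axis_act_pow g (c : R -> X) (al : R) :
  (forall t, a g (c t) = c (t + al)) ->
  forall n t, a (g ^+ n)%g (c t) = c (t + n%:R * al).
Proof.
move=> ac; elim=> [|n IH] t; first by rewrite expg0 act_one mul0r addr0.
by rewrite expgS act_mul IH ac -natr1; congr c; ring.
Qed.

(** A point moved by less than [|al|] would let the orbit of [c 0] progress too slowly, whereas it
    advances by exactly [n * |al|] along the axis. *)
Lemma rank1_translation_length_gt0 g : rank1_isometry (a g) ->
  0 < translation_length a g.
Proof.
move=> [_ [c [[hc [al al0 ac]] _]]].
have alp : 0 < `|al| by rewrite normr_gt0.
apply: (lt_le_trans alp); apply: lb_le_inf;
  first by exists (mdist (c 0) (a g (c 0))), (c 0).
move=> _ [x _ <-]; rewrite leNgt; apply/negP => lt.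
have d0 : 0 < `|al| - mdist x (a g x) by lra.
pose n := (Num.truncn ((2 * mdist (c 0) x) / (`|al| - mdist x (a g x)))).+1.
have hn : 2 * mdist (c 0) x < n%:R * (`|al| - mdist x (a g x)).
  by rewrite -ltr_pdivrMr// truncnS_gt// divr_ge0 ?mulr_ge0 ?mdist_ge0 ?ltW.
have := mdist_act_pow_le g n (c 0) x.
rewrite (axis_act_pow ac) add0r hc sub0r normrN normrM ger0_norm//; lra.
Qed.

Lemma rank1_orbit_contracting g (o : X) : proper_space X ->
  rank1_isometry (a g) ->
  exists D : R, forall (p : X) n, exists s u,
    [/\ s = (g ^+ n)%g \/ s = (g ^+ n)^-1%g, 0 <= u <= 1 &
        mdist o (geo p (a s o) u) <= D].
Proof.
move=> pX [_ [c [[hc [al al0 ac]] nflat]]].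
have acV t : a g^-1%g (c t) = c (t - al).
  by rewrite -{1}(subrK al t) -ac act_invr.
have acVn n t : a (g ^+ n)^-1%g (c t) = c (t - n%:R * al).
  by rewrite -expVgn -mulrN; exact: axis_act_pow.
have [D hD] : exists D : R, forall (p : X) (t : R), 0 <= t ->
    exists2 u : R, 0 <= u <= 1 & mdist (c 0) (geo p (c t) u) <= D \/
      mdist (c 0) (geo p (c (- t)) u) <= D.
  have [alp|aln] := ltP 0 al.
    by apply: (rank1_contracting HX pX hc nflat alp _ _ acV ac); exact: act_mdist.
  have alp : 0 < - al by rewrite oppr_gt0 lt_neqAle al0.
  apply: (rank1_contracting (f := a g) (f' := a g^-1%g) HX pX hc nflat alp) => //;
    try exact: act_mdist.
  by move=> t; rewrite opprK.
(* One [mdist o (c 0)] pays for changing the endpoint [a s (c 0)] into [a s o], the other for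
   changing the centre [c 0] into [o]. *)
exists (D + 2 * mdist o (c 0)) => p n.
have [u u01 hu] := hD p (n%:R * `|al|) (mulr_ge0 (ler0n _ _) (normr_ge0 _)).
have [s [sE hs]] : exists s, (s = (g ^+ n)%g \/ s = (g ^+ n)^-1%g) /\
    mdist (c 0) (geo p (a s (c 0)) u) <= D.
  have e1 := axis_act_pow ac n 0; have e2 := acVn n 0.
  rewrite add0r in e1; rewrite add0r in e2.
  by case: (leP 0 al) hu => al_sg;
    [rewrite ger0_norm//|rewrite ltr0_norm// mulrN opprK];
    case=> h; [exists (g ^+ n)%g|exists (g ^+ n)^-1%g|
               exists (g ^+ n)^-1%g|exists (g ^+ n)%g];
    rewrite ?e1 ?e2; split=> //; auto.
exists s, u; split => //.
have := metric_triangle o (c 0) (geo p (a s o) u).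
have := metric_triangle (c 0) (geo p (a s (c 0)) u) (geo p (a s o) u).
have := geo_ratio HX p (a s (c 0)) (a s o) u01.
rewrite act_mdist (metric_sym (c 0) o).
have := mdist_ge0 o (c 0); have /andP[u0 u1] := u01; nra.
Qed.

End TranslationLength.

(** * Convex cocompactness in the product *)

Section Product.
Context {R : realType} {X1 X2 : metricType R}.
Hypotheses (H1 : cat0_space X1) (H2 : cat0_space X2).

Lemma l2prod_mdist1 (p q : l2prod X1 X2) : mdist p.1 q.1 <= mdist p q.
Proof.
rewrite mdist_l2prodE -[leLHS]ger0_norm ?mdist_ge0// -sqrtr_sqr.
by rewrite ler_wsqrtr// lerDl sqr_ge0.
Qed.

Lemma l2prod_mdist2 (p q : l2prod X1 X2) : mdist p.2 q.2 <= mdist p q.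
Proof.
rewrite mdist_l2prodE -[leLHS]ger0_norm ?mdist_ge0// -sqrtr_sqr.
by rewrite ler_wsqrtr// lerDr sqr_ge0.
Qed.

(** Two geodesics run at proportional speeds form a geodesic for the l^2 distance, so the same [f]
    serves in both factors. *)
Lemma geodesically_convex_geo (C : set (l2prod X1 X2)) (p q : l2prod X1 X2)
    (f : R) : geodesically_convex C -> C p -> C q -> 0 <= f <= 1 ->
  C (geo p.1 q.1 f, geo p.2 q.2 f).
Proof.
move=> Cc Cp Cq f01; have /andP[f0 f1] := f01.
pose g (f : R) : l2prod X1 X2 := (geo p.1 q.1 f, geo p.2 q.2 f).
have gd (s t : R) : 0 <= s <= 1 -> 0 <= t <= 1 ->
    mdist (g s) (g t) = `|s - t| * mdist p q.
  move=> s01 t01; rewrite !mdist_l2prodE /= !geo_mdist// !exprMn -mulrDr.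
  by rewrite sqrtrM ?sqr_ge0// sqrtr_sqr normr_id.
have g0 : g 0 = p by rewrite /g !geo0//; case: (p).
have g1 : g 1 = q by rewrite /g !geo1//; case: (q).
have i0 : 0 <= (0 : R) <= 1 by rewrite lexx ler01.
have [d0|dn0] := eqVneq (mdist p q) 0.
  suff -> : (geo p.1 q.1 f, geo p.2 q.2 f) = p :> l2prod X1 X2 by [].
  by apply: mdist_positivity; rewrite -[X in mdist _ X]g0 gd// d0 mulr0.
have dgt0 : 0 < mdist p q by rewrite lt_neqAle eq_sym dn0 mdist_ge0.
have gp : geodesic_path p q (fun s => g (s / mdist p q)).
  split; rewrite ?mul0r ?divff//.
  have i (s : R) : s \in `[0, mdist p q] -> 0 <= s / mdist p q <= 1.
    by rewrite in_itv /= => /andP[s0 s1];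
    rewrite divr_ge0 ?(ltW dgt0)//= ler_pdivrMr// mul1r.
  move=> s t /i si /i ti; rewrite gd// -mulrBl normrM normfV (gtr0_norm dgt0).
  by rewrite divfK.
have := Cc _ _ _ Cp Cq gp (f * mdist p q).
rewrite /g mulfK//; apply.
by rewrite in_itv /= mulr_ge0 ?(ltW dgt0)//= ler_piMl// ltW.
Qed.

End Product.

Lemma compact_mdist_bounded {R : realType} {X : metricType R} (o : X)
  (K : set X) : compact K -> exists D : R, forall x, K x -> mdist o x <= D.
Proof.
move=> cK; have : compact (mdist o @` K).
  apply: continuous_compact cK; apply: continuous_subspaceT => x.
  by apply: cvg_mdist; [exact: cvg_cst|exact: cvg_id].
move=> /compact_bounded[M [_ hM]]; exists (M + 1) => x Kx.
have := hM (M + 1); rewrite ltrDl ltr01 => /(_ isT (mdist o x)) h.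
apply: le_trans (ler_norm _) (h _); by exists x.
Qed.

Lemma finite_set_bounded {R : realType} {T : choiceType} (A : set T)
  (f : T -> R) : finite_set A -> exists M : R, forall x, A x -> f x <= M.
Proof.
move=> /finite_seqP[s ->]; elim: s => [|y s [M hM]]; first by exists 0.
exists (Num.max (f y) M) => x /=; rewrite in_cons => /orP[/eqP ->|xs].
  by rewrite le_max lexx.
by rewrite le_max (hM x xs) orbT.
Qed.

(* A point of [C] is an orbit translate of a point in a fixed compact set; if
   its first coordinate is bounded then, by properness on [X1] alone, the
   translating element ranges over a finite set. *)
Lemma cocompact_coordinate_bounded {R : realType} {G : groupType}
    {X1 X2 : metricType R} (a1 : isometric_action G X1)
    (a2 : isometric_action G X2) (C K : set (l2prod X1 X2)) (o : l2prod X1 X2) :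
  proper_space X1 -> proper_action a1 -> compact K ->
  C `<=` \bigcup_g (diagonal_action a1 a2 g @` K) ->
  forall D : R, exists D' : R, forall w, C w ->
    mdist o.1 w.1 <= D -> mdist o.2 w.2 <= D'.
Proof.
move=> pX1 pa1 cK CK D.
have [E hE] := compact_mdist_bounded o cK.
pose B : set X1 := [set y | mdist o.1 y <= Num.max D E].
have [M hM] := finite_set_bounded (fun g => mdist o.2 (a2 g o.2))
  (pa1 B (@pX1 o.1 (Num.max D E))).
exists (M + E) => w Cw ow; have [g _ [k Kk kw]] := CK _ Cw.
have ok := hE _ Kk; rewrite -kw /= in ow *.
have gF : (a1 g @` B) `&` B !=set0.
  exists (a1 g k.1); split; last by rewrite /B /= le_max ow.
  exists k.1 => //; rewrite /B /= le_max (le_trans (l2prod_mdist1 _ _) ok).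
  by rewrite orbT.
apply: le_trans (metric_triangle _ (a2 g o.2) _) _.
apply: lerD; first exact: hM.
by rewrite act_mdist (le_trans (l2prod_mdist2 _ _) ok).
Qed.

(** With [f * M] and [(1 - f) * M] in place of [A] and [B] the cross products cancel. The remaining
    error is linear in the lengths, hence negligible after division by the square of the scale. *)
Lemma cross_ratio_bound {R : realType} (A1 B1 M1 A2 B2 M2 f E : R) :
  0 <= f <= 1 -> 0 <= M1 -> 0 <= M2 -> M1 <= A1 + B1 -> M2 <= A2 + B2 ->
  0 <= B1 -> 0 <= B2 ->
  `|f * M1 - A1| <= E -> `|(1 - f) * M1 - B1| <= E ->
  `|f * M2 - A2| <= E -> `|(1 - f) * M2 - B2| <= E ->
  `|A1 * B2 - A2 * B1| <= E * (A1 + 2 * B1 + A2 + 2 * B2).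
Proof.
move=> /andP[f0 f1] M10 M20 hM1 hM2 B10 B20 h1 h2 h3 h4.
have E0 : 0 <= E by exact: le_trans (normr_ge0 _) h1.
set e1 := f * M1 - A1 in h1; set e2 := (1 - f) * M1 - B1 in h2.
set e3 := f * M2 - A2 in h3; set e4 := (1 - f) * M2 - B2 in h4.
have -> : A1 * B2 - A2 * B1 =
  f * M2 * e2 - f * M1 * e4 + (e3 * B1 - e1 * B2).
  by rewrite /e1 /e2 /e3 /e4; ring.
have b2 : `|f * M2 * e2| <= M2 * E.
  rewrite !normrM (ger0_norm f0) (ger0_norm M20) ler_pM ?mulr_ge0//.
  by rewrite ler_piMl.
have b4 : `|f * M1 * e4| <= M1 * E.
  rewrite !normrM (ger0_norm f0) (ger0_norm M10) ler_pM ?mulr_ge0//.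
  by rewrite ler_piMl.
have b3 : `|e3 * B1| <= E * B1 by rewrite normrM (ger0_norm B10) ler_wpM2r.
have b1 : `|e1 * B2| <= E * B2 by rewrite normrM (ger0_norm B20) ler_wpM2r.
have n1 := ler_normD (f * M2 * e2 - f * M1 * e4) (e3 * B1 - e1 * B2).
have n2 := ler_normB (f * M2 * e2) (f * M1 * e4).
have n3 := ler_normB (e3 * B1) (e1 * B2).
have m1 := ler_wpM2l E0 hM1; have m2 := ler_wpM2l E0 hM2.
lra.
Qed.

Lemma cvg_ratio_unique {R : realType} (A1 B1 A2 B2 : nat -> R)
    (x1 y1 x2 y2 E : R) :
  A1 k / 2 ^+ k @[k --> \oo] --> x1 -> B1 k / 2 ^+ k @[k --> \oo] --> y1 ->
  A2 k / 2 ^+ k @[k --> \oo] --> x2 -> B2 k / 2 ^+ k @[k --> \oo] --> y2 ->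
  (forall k, `|A1 k * B2 k - A2 k * B1 k| <=
    E * (A1 k + 2 * B1 k + A2 k + 2 * B2 k)) ->
  x1 * y2 = x2 * y1.
Proof.
move=> cA1 cB1 cA2 cB2 le.
have p2 k : (2 : R) ^+ k != 0 by rewrite expf_neq0.
pose al k := A1 k / 2 ^+ k; pose be k := B1 k / 2 ^+ k.
pose al' k := A2 k / 2 ^+ k; pose be' k := B2 k / 2 ^+ k.
have c1 : `|al k * be' k - al' k * be k| @[k --> \oo] --> `|x1 * y2 - x2 * y1|.
  by apply: cvg_norm; apply: cvgB; exact: cvgM.
have c2 : E * (al k + 2 * be k + al' k + 2 * be' k) * 2^-1 ^+ k
    @[k --> \oo] --> E * (x1 + 2 * y1 + x2 + 2 * y2) * 0.
  apply: cvgM; last first.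
    by apply: cvg_expr; rewrite ger0_norm; lra.
  apply: cvgM; first exact: cvg_cst.
  have cst : (fun=> 2 : R) @ \oo --> (2 : R) by exact: cvg_cst.
  by apply: cvgD; [apply: cvgD; [apply: cvgD => //|]|]; try exact: cvgM.
have : `|x1 * y2 - x2 * y1| <= E * (x1 + 2 * y1 + x2 + 2 * y2) * 0.
  apply: (ler_cvg_to c1 c2); near=> k.
  have k0 : 0 < (2 : R) ^+ k by rewrite exprn_gt0.
  have -> : al k * be' k - al' k * be k =
      (A1 k * B2 k - A2 k * B1 k) / (2 ^+ k * 2 ^+ k).
    by rewrite /al /be /al' /be'; field.
  rewrite normrM [X in _ * X]gtr0_norm ?invr_gt0 ?mulr_gt0//.
  rewrite ler_pdivrMr ?mulr_gt0//; apply: le_trans (le k) _.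
  rewrite le_eqVlt; apply/orP; left; apply/eqP.
  by rewrite /al /be /al' /be' exprVn; field.
by rewrite mulr0 normr_le0 subr_eq0 => /eqP.
Unshelve. all: by end_near. Qed.

Theorem theorem1p10 (R : realType) (G : groupType) (X1 X2 : metricType R)
    (a1 : isometric_action G X1) (a2 : isometric_action G X2) :
  proper_space X1 -> cat0_space X1 ->
  proper_space X2 -> cat0_space X2 ->
  proper_action a1 -> proper_action a2 ->
  has_rank1_isometries a1 -> has_rank1_isometries a2 ->
  convex_cocompact (diagonal_action a1 a2) ->
  same_length_spectrum_up_to_rescaling a1 a2.
Proof.
move=> pX1 H1 _ H2 pa1 _ [h rh] [h' rh'].
move=> [C [C0 _ Cconv Cinv [K [cK _ CK]]]]; case: C0 => o Co.
suff cross g : translation_length a1 g * translation_length a2 h =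
    translation_length a2 g * translation_length a1 h.
  have l1 := rank1_translation_length_gt0 rh.
  have l2' := rank1_translation_length_gt0 rh'.
  have l2 : 0 < translation_length a2 h.
    (* [h] need not be rank-1 on [X2]; the relation at [h'], which is rank-1 there, shows that its
       length on [X2] is nonzero. *)
    have := cross h'; have := mulr_gt0 l2' l1 => /[swap] <- pos.
    rewrite lt_neqAle; apply/andP; split.
      by apply: contraTneq pos => <-; rewrite mulr0 ltxx.
    apply: lb_le_inf; first by exists (mdist o.2 (a2 h o.2)), o.2.
    by move=> _ [x _ <-]; exact: mdist_ge0.
  exists (translation_length a1 h / translation_length a2 h).
    by rewrite divr_gt0.
  move=> g; rewrite mulrAC [X in X / _]mulrC -cross mulfK// gt_eqF//.
have [D hD] := rank1_orbit_contracting H1 o.1 pX1 rh.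
have [D' hD'] := cocompact_coordinate_bounded o pX1 pa1 cK CK D.
pose E := Num.max D D'.
pose orb (X : metricType R) (a : isometric_action G X) (x : X) g' k : R :=
  mdist x (a (g' ^+ (2 ^ k)%N)%g x).
apply: (@cvg_ratio_unique _ (orb _ a1 o.1 g) (orb _ a1 o.1 h)
  (orb _ a2 o.2 g) (orb _ a2 o.2 h) _ _ _ _ E);
  try exact: translation_length_cvg.
rewrite /orb => k.
have [s [f [sE f01 near1]]] := hD (a1 (g ^+ (2 ^ k)%N)%g o.1) (2 ^ k)%N.
(* Which of the two powers is [s] varies with [k], but an element and its inverse displace [x]
   equally, so the limits are unaffected. *)
have inv (X : metricType R) (a : isometric_action G X) (x : X) :
    mdist x (a (h ^+ (2 ^ k)%N)%g x) = mdist x (a s x).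
  by case: sE => ->//; rewrite act_inv_mdist.
rewrite !inv.
set p1 := a1 (g ^+ (2 ^ k)%N)%g o.1 in near1 *; set q1 := a1 s o.1 in near1 *.
set p2 := a2 (g ^+ (2 ^ k)%N)%g o.2; set q2 := a2 s o.2.
pose w : l2prod X1 X2 := (geo p1 q1 f, geo p2 q2 f).
have Cw : C w.
  have Cp : C ((p1, p2) : l2prod X1 X2) := Cinv (g ^+ (2 ^ k)%N)%g o Co.
  have Cq : C ((q1, q2) : l2prod X1 X2) := Cinv s o Co.
  exact: (geodesically_convex_geo H1 H2 Cconv Cp Cq f01).
have near2 : mdist o.2 (geo p2 q2 f) <= D' by exact: (hD' _ Cw near1).
have est (X : metricType R) (HX : cat0_space X) (x p q : X) :
    mdist x (geo p q f) <= E -> `|f * mdist p q - mdist x p| <= E /\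
      `|(1 - f) * mdist p q - mdist x q| <= E.
  move=> le; rewrite -(geo_mdistl HX p q f01) -(geo_mdistr HX p q f01).
  have := metric_triangle x (geo p q f) p; have := metric_triangle x (geo p q f) q.
  have := metric_triangle p x (geo p q f); have := metric_triangle (geo p q f) x q.
  rewrite (metric_sym (geo p q f) p) (metric_sym p x) (metric_sym (geo p q f) x).
  by move=> *; split; rewrite ler_norml; apply/andP; split; lra.
have nE1 : mdist o.1 (geo p1 q1 f) <= E by rewrite le_max near1.
have nE2 : mdist o.2 (geo p2 q2 f) <= E by rewrite le_max near2 orbT.
have [e1 e2] := est _ H1 _ _ _ nE1; have [e3 e4] := est _ H2 _ _ _ nE2.
apply: (cross_ratio_bound f01 _ _ _ _ _ _ e1 e2 e3 e4);
  rewrite ?mdist_ge0//.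
- by rewrite (metric_sym o.1 p1); exact: metric_triangle.
- by rewrite (metric_sym o.2 p2); exact: metric_triangle.
Qed.
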